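(* Every non-collinear visibility graph with minimum degree $\delta$ has vertex-connectivity at least $\frac{\delta}{2}+1$.
   Context: For a finite set $P$ of points in the plane, two distinct points $v,w$ are visible with respect to $P$ if no point of $P$ lies in the open line segment $vw$. The visibility graph of $P$ has vertex set $P$, with $v,w$ adjacent iff they are visible with respect to $P$. A visibility graph is non-collinear if $P$ does not lie on a single line. *)

(* Defs.v *)
From HB Require Import structures.
From mathcomp Require Import all_boot all_order all_algebra finmap.
From mathcomp Require Import boolp reals.

Set Implicit Arguments.
Unset Strict Implicit.
Unset Printing Implicit Defensive.

Import Order.TTheory GRing.Theory Num.Theory.

Local Open Scope ring_scope.

Section Graph.
Variables (T : finType) (e : rel T).

Definition degree (v : T) : nat := #|[pred w | e v w]|.

(* The default #|T| is never attained by a degree in a loopless graph, so on a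
   nonempty vertex type this is the true minimum. *)
Definition min_degree : nat := \big[minn/#|T|%N]_(v : T) degree v.

Definition del_rel (S : {set T}) : rel T :=
  [rel v w | [&& e v w, v \notin S & w \notin S]].

Definition connected_del (S : {set T}) : bool :=
  [forall v in ~: S, forall w in ~: S, connect (del_rel S) v w].

(* At least k + 1 vertices, and still connected after the deletion of any
   fewer than k vertices. *)
Definition vertex_connected (k : nat) : bool :=
  (k < #|T|)%N && [forall S : {set T}, (#|S| < k)%N ==> connected_del S].

(* The bound on k is no restriction, as vertex_connected k forces k < #|T|; in
   particular the complete graph on n > 0 vertices gets n - 1. *)
Definition vertex_connectivity : nat :=
  (\max_(k < #|T| | vertex_connected k) k)%N.

End Graph.

Section Plane.
Variable R : realType.
Implicit Types (v w x : 'rV[R]_2) (P : {fset 'rV[R]_2}).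

Definition open_segment v w x : Prop :=
  exists2 t : R, 0 < t < 1 & x = (1 - t) *: v + t *: w.

Definition visible P v w : Prop :=
  v <> w /\ forall x, x \in P -> ~ open_segment v w x.

Definition visibility_graph P : rel P :=
  fun v w : P => `[< visible P (val v) (val w) >].

Definition collinear P : Prop :=
  exists a d : 'rV[R]_2,
    d <> 0 /\ forall x, x \in P -> exists t : R, x = a + t *: d.

End Plane.

Arguments visibility_graph {R} P.

(* Main.v *)
(** Let S be a cut of the visibility graph, A one component of the rest and B
    the others.  No point of A sees a point of B, so every open segment between
    A and B contains a point of S.  If A and B lie on a common line, an extreme
    vertex of A and B on it has degree at most |S|, and |S| >= 2.  Otherwise
    |S| > min(|A|,|B|) (lemma [blocking_bound]), and as a vertex of A has its
    neighbours in A and S, the minimum degree is at most 2|S| - 2.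

    The bound |S| > min(|A|,|B|) is proved by induction on |A| + |B| together
    with a version relative to a supporting line with points of both colours
    on it, which counts only the blockers off that line and is weaker by one.
    - The general bound from the line version: sort A and B around an extreme point p, choose
      by a balancing argument a line through p that contains a point of the
      other colour, and add the line bounds on its two sides to the blocker that
      lies on it.
    - The line version: let A be the majority on the line.  The lowest point off
      the line sees the line points of the other colour through distinct
      blockers, and the general bound applies to the points off the line.  This
      fails only if A leads by at least two on the line and B leads by at least
      two off it.  Then either an initial segment of the line is balanced and
      can be peeled off with a fan from one point, or the first two line points
      are in A, and a line crossing just after them cuts off a part in which A
      leads by one. *)
Require Import Defs.
From HB Require Import structures.
From mathcomp Require Import all_boot all_order all_algebra finmap.
From mathcomp Require Import boolp reals ring lra zify.

Set Implicit Arguments.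
Unset Strict Implicit.
Unset Printing Implicit Defensive.

Import Order.TTheory GRing.Theory Num.Theory.

Local Open Scope ring_scope.

(** * Counting and extremal choice in finite sets *)

Lemma card_le_inj (T : finType) (S D : {set T}) (Q : T -> T -> Prop) :
  (forall s, s \in S -> exists2 c, c \in D & Q s c) ->
  (forall s s' c, s \in S -> s' \in S -> Q s c -> Q s' c -> s = s') ->
  (#|S| <= #|D|)%N.
Proof.
move=> ex uq.
have /choice[f fP] : forall s, exists c, s \in S -> c \in D /\ Q s c.
  move=> s; case: (boolP (s \in S)) => [sS|_]; last by exists s.
  by have [c cD q] := ex s sS; exists c.
have finj : {in S &, injective f}.
  move=> s s' sS s'S e; apply: (uq s s' (f s)) => //; first by case: (fP s sS).
  by rewrite e; case: (fP s' s'S).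
rewrite -(card_in_imset finj); apply: subset_leq_card.
by apply/subsetP => _ /imsetP[s sS ->]; case: (fP s sS).
Qed.

Lemma exists_notin_seq (R : realFieldType) (u v : R) (s : seq R) :
  u < v -> exists2 q, u < q < v & q \notin s.
Proof.
elim: s u v => [|r s IH] u v uv.
  by exists ((u + v) / 2) => //; apply/andP; split; lra.
have [/andP[ur rv]|nr] := boolP (u < r < v).
  have [q /andP[uq qr] qs] := IH _ _ ur.
  exists q; first by apply/andP; split; lra.
  by rewrite inE negb_or qs andbT lt_eqF.
have [q qi qs] := IH _ _ uv; exists q => //.
rewrite inE negb_or qs andbT; apply: contraNneq nr => <-; exact: qi.
Qed.

Lemma arg_min_exists (R : realFieldType) (T : finType) (f : T -> R) (S : {set T}) :
  S != set0 -> exists2 i, i \in S & forall j, j \in S -> f i <= f j.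
Proof.
case/set0Pn=> i0 i0S.
by case: (arg_minP f i0S) => i iS H; exists i.
Qed.

Lemma exists_between (R : realFieldType) (T : finType) (f : T -> R) (S S' : {set T}) :
  S != set0 -> S' != set0 ->
  (forall s s', s \in S -> s' \in S' -> f s < f s') ->
  exists u v, [/\ u < v, forall s, s \in S -> f s <= u &
                    forall s, s \in S' -> v <= f s].
Proof.
move=> S0 S'0 lt.
have [i iS iP] := arg_min_exists (fun s => - f s) S0.
have [j jS jP] := arg_min_exists f S'0.
exists (f i), (f j); split; [exact: lt| |exact: jP].
by move=> s /iP; rewrite lerN2.
Qed.

(* Discrete intermediate value theorem for the colour excess of initial segments. *)
Lemma downset_excess (R : realFieldType) (T : finType) (f : T -> R) (A B S : {set T}) (g : nat) :
  [disjoint A & B] -> S \subset A :|: B -> {in S &, injective f} ->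
  (#|B :&: S| + g <= #|A :&: S|)%N ->
  exists D : {set T}, [/\ D \subset S, (#|A :&: D| = #|B :&: D| + g)%N &
    forall s s', s \in D -> s' \in S :\: D -> f s < f s'].
Proof.
move=> dAB.
elim: {S}_.+1 {-2}S (ltnSn #|S|) => // m IH S Sm SAB finj le.
case: (ltngtP (#|B :&: S| + g)%N #|A :&: S|) (le) => // [lt _|eq _]; last first.
  exists S; split=> //; move=> s s'; by rewrite setDv inE.
have [S0|Sn0] := eqVneq S set0.
  by move: lt; rewrite S0 !setI0 cards0.
(* Deleting the largest element changes the excess by at most one, so an excess above [g] stays at
   least [g]. *)
have [i iS iP] := arg_min_exists (fun s => - f s) Sn0.
have sub : S :\ i \subset S by rewrite subsetDl.
have ci (E : {set T}) : #|E :&: S| = ((i \in E) + #|E :&: (S :\ i)|)%N.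
  rewrite (cardsD1 i (E :&: S)) inE iS andbT; congr (_ + #|pred_of_set _|)%N.
  by apply/setP => k; rewrite !inE; case: (k == i); case: (k \in E); case: (k \in S).
have nAB : ~~ ((i \in A) && (i \in B)).
  by apply/negP => /andP[iA iB]; move: (disjointFr dAB iA); rewrite iB.
have [||||D [DS eD lD]] := IH (S :\ i).
- by move: Sm; rewrite (cardsD1 i S) iS.
- exact: subset_trans sub SAB.
- move=> u v uS vS; apply: finj; exact: (subsetP sub).
- move: lt; rewrite !ci; move: nAB; case: (i \in A); case: (i \in B) => //= _; lia.
exists D; split=> //; first exact: subset_trans DS sub.
move=> s s' sD; rewrite !inE => /andP[s'D s'S].
have [e|ne] := eqVneq s' i; last by apply: lD => //; rewrite !inE s'D ne.
have := subsetP DS _ sD; rewrite !inE => /andP[si sS].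
rewrite e lt_neqAle -lerN2 iP // andbT.
by apply: contra si => /eqP /finj ->.
Qed.

(** Cardinals become plain variables before [lia]. The context is cleared, so every fact needed must
    stand in the goal. *)
Ltac card_lia :=
  repeat match goal with |- context [card ?S] => generalize (card S) end;
  clear; lia.

(** * Segments, affine functions and coordinate frames *)

Section PlanarPoints.
Variables (R : realFieldType) (T : finType) (x0 y0 : T -> R).
Hypothesis coord_inj : forall i j, x0 i = x0 j -> y0 i = y0 j -> i = j.
Implicit Types (A B C D S : {set T}) (F : T -> R).

Definition seg (a b c : T) : Prop := exists2 t : R, 0 < t < 1 &
  x0 c = (1 - t) * x0 a + t * x0 b /\ y0 c = (1 - t) * y0 a + t * y0 b.

(** Twice the signed area of the triangle [i j k]. *)
Definition det (x y : T -> R) (i j k : T) : R :=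
  (x j - x i) * (y k - y i) - (y j - y i) * (x k - x i).

Definition coll S : Prop :=
  forall i j k, i \in S -> j \in S -> k \in S -> det x0 y0 i j k = 0.

Definition aff F : Prop :=
  exists u v w : R, forall i, F i = u * x0 i + v * y0 i + w.

(* Affine coordinates; the determinant condition makes collinearity independent
   of the choice of coordinates. *)
Definition frame (x y : T -> R) : Prop := [/\ aff x, aff y,
  forall i j, x i = x j -> y i = y j -> i = j &
  exists2 k, k != 0 & forall i j l, det x y i j l = k * det x0 y0 i j l].

Lemma seg_sym a b c : seg a b c -> seg b a c.
Proof.
case=> t ti [ex ey]; exists (1 - t); first by lra.
by rewrite ex ey; split; ring.
Qed.

Lemma aff_comb F G H p q r : aff F -> aff G ->
  (forall i, H i = p * F i + q * G i + r) -> aff H.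
Proof.
move=> [u [v [w eF]]] [u' [v' [w' eG]]] eH.
exists (p * u + q * u'), (p * v + q * v'), (p * w + q * w' + r) => i.
by rewrite eH eF eG; ring.
Qed.

Lemma aff_seg F a b c : aff F -> seg a b c ->
  exists2 t : R, 0 < t < 1 & F c = (1 - t) * F a + t * F b.
Proof.
case=> u [v [w eF]] [t ti [ex ey]]; exists t => //.
by rewrite !eF ex ey; ring.
Qed.

Lemma aff_seg_lt F a b c k : aff F -> seg a b c ->
  F a < k -> F b <= k -> F c < k.
Proof.
by move=> /aff_seg h /h[t ti ->] ak bk; nra.
Qed.

Lemma aff_seg_gt F a b c k : aff F -> seg a b c ->
  k < F a -> k <= F b -> k < F c.
Proof.
by move=> /aff_seg h /h[t ti ->] ak bk; nra.
Qed.

Lemma aff_seg_ge F a b c k : aff F -> seg a b c ->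
  k <= F a -> k <= F b -> k <= F c.
Proof.
by move=> /aff_seg h /h[t ti ->] ak bk; nra.
Qed.

Lemma aff_seg_eq F a b c k : aff F -> seg a b c ->
  F a = k -> F b = k -> F c = k.
Proof.
by move=> /aff_seg h /h[t ti ->] -> ->; ring.
Qed.

Lemma aff_seg_eq0 F a b c : aff F -> seg a b c ->
  F a = 0 -> F c = 0 -> F b = 0.
Proof.
move=> /aff_seg h /h[t /andP[t0 _] ->] ->; rewrite mulr0 add0r => /eqP.
by rewrite mulf_eq0 gt_eqF // => /eqP.
Qed.

Lemma frame0 : frame x0 y0.
Proof.
split; [by exists 1, 0, 0 => i; ring|by exists 0, 1, 0 => i; ring|exact: coord_inj|].
by exists 1 => [|i j l]; rewrite ?oner_eq0 ?mul1r.
Qed.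

Lemma frame_comb x y x' y' p q r p' q' r' : frame x y ->
  p * q' - q * p' != 0 ->
  (forall i, x' i = p * x i + q * y i + r) ->
  (forall i, y' i = p' * x i + q' * y i + r') -> frame x' y'.
Proof.
move=> [ax ay xyI [k k0 ek]] d0 ex ey; split.
- exact: aff_comb ax ay ex.
- exact: aff_comb ax ay ey.
- move=> i j; rewrite !ex !ey => e e'.
  (* Cramer's rule recovers the old coordinate differences from the new ones. *)
  apply: xyI; apply/eqP; rewrite -subr_eq0 -(mulrI_eq0 _ (mulfI d0)); apply/eqP.
    by transitivity (q' * ((p * x i + q * y i + r) - (p * x j + q * y j + r))
      - q * ((p' * x i + q' * y i + r') - (p' * x j + q' * y j + r'))); [ring|rewrite e e'; ring].
  by transitivity (p * ((p' * x i + q' * y i + r') - (p' * x j + q' * y j + r'))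
      - p' * ((p * x i + q * y i + r) - (p * x j + q * y j + r))); [ring|rewrite e e'; ring].
exists ((p * q' - q * p') * k); first by rewrite mulf_neq0.
by move=> i j l; rewrite -mulrA -ek /det !ex !ey; ring.
Qed.

Lemma frame_coll x y S : frame x y ->
  (forall i j k, i \in S -> j \in S -> k \in S -> det x y i j k = 0) <-> coll S.
Proof.
case=> _ _ _ [k k0 ek]; split=> h i j l iS jS lS; last by rewrite ek h ?mulr0.
by have /eqP := h i j l iS jS lS; rewrite ek mulf_eq0 (negPf k0) => /eqP.
Qed.

Lemma frame_aff x y F p q r : frame x y ->
  (forall i, F i = p * x i + q * y i + r) -> aff F.
Proof. by case=> ax ay _ _; exact: aff_comb. Qed.

Lemma frame_inj x y : frame x y -> forall i j, x i = x j -> y i = y j -> i = j.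
Proof. by case. Qed.

Lemma frame_affy x y : frame x y -> aff y. Proof. by case. Qed.

Lemma det_aff x y i j : frame x y -> aff (det x y i j).
Proof.
move=> fr; apply: (frame_aff (p := - (y j - y i)) (q := x j - x i)
  (r := (y j - y i) * x i - (x j - x i) * y i) fr) => k.
by rewrite /det; ring.
Qed.

(** If [k], [l], [m] were not collinear, an affine function vanishing at all three would be
    constant; for [det x y i j] this means that [i] and [j] have equal coordinates. *)
Lemma det_line x y i j k l m : frame x y -> i <> j ->
  det x y i j k = 0 -> det x y i j l = 0 -> det x y i j m = 0 ->
  det x y k l m = 0.
Proof.
move=> fr ij ek el em; apply/eqP; apply/negP => /negP nz.
apply: ij; apply: (frame_inj fr); apply/esym/eqP;
  rewrite -subr_eq0 -(mulIr_eq0 _ (mulIf nz)); apply/eqP.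
  transitivity ((x l - x k) * (det x y i j m - det x y i j k)
     - (x m - x k) * (det x y i j l - det x y i j k)); last by rewrite ek el em; ring.
  by rewrite /det; ring.
transitivity ((y l - y k) * (det x y i j m - det x y i j k)
     - (y m - y k) * (det x y i j l - det x y i j k)); last by rewrite ek el em; ring.
by rewrite /det; ring.
Qed.

(** * Blockers between two colour classes *)

Definition hits A B C : Prop :=
  forall a b, a \in A -> b \in B -> exists2 c, c \in C & seg a b c.

(* Pairs on the line [y = 0] are exempt, so that a bound on such a [C] counts only
   the blockers off that line. *)
Definition hits_off (y : T -> R) A B C : Prop :=
  forall a b, a \in A -> b \in B -> (0 < y a) || (0 < y b) ->
  exists2 c, c \in C & seg a b c.

Lemma hits_sym A B C : hits A B C -> hits B A C.
Proof. by move=> h a b aB bA; have [c cC /seg_sym s] := h b a bA aB; exists c. Qed.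

Lemma hits_off_sym y A B C : hits_off y A B C -> hits_off y B A C.
Proof.
by move=> h a b aB bA; rewrite orbC => /(h b a bA aB)[c cC /seg_sym s]; exists c.
Qed.

(** The segments from [z] to distinct points of a line avoiding [z] meet only in [z], so no blocker
    serves two of them. *)
Lemma fan_bound x y z S D : frame x y -> 0 < y z ->
  (forall s, s \in S -> y s = 0) ->
  (forall s, s \in S -> exists2 c, c \in D & seg z s c) -> (#|S| <= #|D|)%N.
Proof.
move=> fr z0 S0 ex; apply: (card_le_inj ex) => s s' c sS s'S q q'.
pose G w := (x w - x s) * y z - (x z - x s) * y w.
have aG : aff G.
  apply: (frame_aff (p := y z) (q := - (x z - x s)) (r := - x s * y z) fr) => w.
  by rewrite /G; ring.
have Gc : G c = 0 by apply: (aff_seg_eq aG q); rewrite /G ?(S0 _ sS); ring.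
have Gz : G z = 0 by rewrite /G; ring.
have := aff_seg_eq0 aG q' Gz Gc.
rewrite /G (S0 _ s'S) mulr0 subr0 => /eqP; rewrite mulf_eq0 (gt_eqF z0) orbF subr_eq0.
by move=> /eqP e; apply: (frame_inj fr); rewrite ?e ?S0.
Qed.

Definition setneg F S := [set i in S | F i < 0].
Definition setzero F S := [set i in S | F i == 0].
Definition setpos F S := [set i in S | 0 < F i].
Definition setge F S := [set i in S | 0 <= F i].

Lemma in_sign F S i : ((i \in setneg F S) = (i \in S) && (F i < 0))
  * ((i \in setzero F S) = (i \in S) && (F i == 0))
  * ((i \in setpos F S) = (i \in S) && (0 < F i))
  * ((i \in setge F S) = (i \in S) && (0 <= F i)).
Proof. by rewrite !inE. Qed.

Lemma card_neg_ge F S : #|S| = (#|setneg F S| + #|setge F S|)%N.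
Proof.
rewrite -(cardsID (setneg F S) S); congr (_ + _)%N; apply: eq_card => i;
  rewrite !inE; case: (i \in S) => //=; by case: ltP.
Qed.

Lemma card_sign F S : #|S| = (#|setneg F S| + #|setzero F S| + #|setpos F S|)%N.
Proof.
rewrite (card_neg_ge F) -addnA; congr (_ + _)%N.
rewrite -(cardsID (setzero F S) (setge F S)); congr (_ + _)%N; apply: eq_card => i;
  rewrite !inE; case: (i \in S) => //=; by case: ltgtP.
Qed.

Lemma card_zero_pos F S : (forall i, i \in S -> 0 <= F i) ->
  #|S| = (#|setzero F S| + #|setpos F S|)%N.
Proof.
move=> h; rewrite (card_sign F) (_ : setneg F S = set0) ?cards0 //.
apply/setP => i; rewrite !inE; apply/negP => /andP[/h]; by rewrite ltNge => ->.
Qed.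

(** The segments from one point of [A] to all of [B], and from one point of [B] to all of [A], form
    a double star with [#|A| + #|B| - 1] edges. With suitable centres its edges have distinct
    blockers. *)
Lemma strip_bound x y A B C : frame x y ->
  (forall a, a \in A -> y a = 0) -> (forall b, b \in B -> 0 < y b) ->
  A != set0 -> B != set0 ->
  (forall a b b', a \in A -> b \in B -> b' \in B -> det x y a b b' = 0 -> b = b') ->
  hits A B C -> (#|A| + #|B| <= #|C|.+1)%N.
Proof.
move=> fr A0 B0 An Bn inj h.
have [a1 a1A a1P] := arg_min_exists x An.
have [b1 b1B b1P] := arg_min_exists (fun b => - ((x b - x a1) / y b)) Bn.
(* By the choice of [b1], the line through [a1] and [b1] separates the fan from
   [a1] to [B] from the fan from [b1] to [A]. *)
pose F b w := (x w - x a1) * y b - (x b - x a1) * y w.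
have aF b : aff (F b).
  apply: (frame_aff (p := y b) (q := - (x b - x a1)) (r := - x a1 * y b) fr) => w.
  by rewrite /F; ring.
have Fa1 b : F b a1 = 0 by rewrite /F (A0 _ a1A); ring.
have Fb b : F b b = 0 by rewrite /F; ring.
have Finj b b' : b \in B -> b' \in B -> F b b' = 0 -> b = b'.
  move=> bB b'B e; apply: (inj a1) => //.
  have -> : det x y a1 b b' = - F b b' by rewrite /F /det (A0 _ a1A); ring.
  by rewrite e oppr0.
have sub b a : a \in A -> a != a1 -> 0 < y b -> 0 < F b a.
  move=> aA aa1 b0; rewrite /F (A0 _ aA) mulr0 subr0 mulr_gt0 // subr_gt0 lt_neqAle a1P // andbT.
  by apply: contra aa1 => /eqP e; apply/eqP/(frame_inj fr); rewrite ?A0.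
have := card_sign (F b1) C.
have h0 : (0 < #|setzero (F b1) C|)%N.
  have [c cC s] := h a1 b1 a1A b1B; apply/card_gt0P; exists c; rewrite in_sign cC /=.
  by apply/eqP/(aff_seg_eq (aF b1) s).
have h1 : (#|A :\ a1| <= #|setpos (F b1) C|)%N.
  apply: (fan_bound fr (B0 _ b1B)) => [s|s]; rewrite !inE => /andP[sa1 sA]; first exact: A0.
  have [c cC sg] := h s b1 sA b1B; exists c; last exact: seg_sym.
  rewrite in_sign cC /=; apply: (aff_seg_gt (aF b1) sg); last by rewrite Fb.
  by apply: sub => //; exact: B0.
have h2 : (#|B :\ b1| <= #|setneg (F b1) C|)%N.
  apply: (@card_le_inj _ _ _ (seg a1)) => [b|b b' c].
    rewrite !inE => /andP[bb1 bB]; have [c cC sg] := h a1 b a1A bB; exists c => //.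
    rewrite in_sign cC /=; apply: (aff_seg_lt (aF b1) (seg_sym sg)); last by rewrite Fa1.
    have b0 := B0 _ bB; have b10 := B0 _ b1B.
    have : F b1 b <= 0.
      by have := b1P _ bB; rewrite lerN2 ler_pdivrMr // mulrAC ler_pdivlMr // /F subr_le0.
    rewrite le_eqVlt => /orP[/eqP e|//].
    by move: bb1; rewrite (Finj _ _ b1B bB e) eqxx.
  rewrite !inE => /andP[_ bB] /andP[_ b'B] q q'.
  have Fc : F b c = 0 by apply: (aff_seg_eq (aF b) q).
  exact: Finj (aff_seg_eq0 (aF b) q' (Fa1 b) Fc).
move: h0 h1 h2; rewrite (cardsD1 a1 A) a1A (cardsD1 b1 B) b1B /=; card_lia.
Qed.

(** * The simultaneous induction on the number of coloured points *)

Definition plane_bound (n : nat) : Prop := forall A B C,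
  [disjoint A & B] -> (#|A| + #|B| <= n)%N -> A != set0 -> B != set0 ->
  ~ coll (A :|: B) -> hits A B C -> (minn #|A| #|B| < #|C|)%N.

(** The frame is quantified inside, so that the induction hypothesis applies to any supporting line
    after a change of coordinates. A point off the line is required because otherwise [hits_off]
    would say nothing. *)
Definition line_bound (n : nat) : Prop := forall (x y : T -> R) A B C,
  frame x y -> [disjoint A & B] -> (#|A| + #|B| <= n)%N ->
  (forall i, i \in A :|: B -> 0 <= y i) ->
  (exists2 a, a \in A & y a = 0) -> (exists2 b, b \in B & y b = 0) ->
  (exists2 z, z \in A :|: B & 0 < y z) ->
  hits_off y A B C -> (minn #|A| #|B| <= #|C|)%N.

(** If both colours occur on the line, this is [line_bound]. If one is missing there, every
    bichromatic pair has an end off the line, so all pairs are blocked and [plane_bound] applies;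
    [l], [l'] and [z] witness noncollinearity. *)
Lemma half_bound n : line_bound n -> plane_bound n ->
  forall (x y : T -> R) A B C l l' z,
  frame x y -> [disjoint A & B] -> (#|A| + #|B| <= n)%N ->
  (forall i, i \in A :|: B -> 0 <= y i) ->
  l \in A :|: B -> l' \in A :|: B -> l != l' -> y l = 0 -> y l' = 0 ->
  z \in A :|: B -> 0 < y z ->
  hits_off y A B C -> (minn #|A| #|B| <= #|C|)%N.
Proof.
move=> lb pb x y A B C l l' z fr dAB sz y_ge0 lX l'X ll' yl yl' zX z0 h.
have [->|An] := eqVneq A set0; first by rewrite cards0 min0n.
have [->|Bn] := eqVneq B set0; first by rewrite cards0 minn0.
have [ea|na] := pselect (exists2 a, a \in A & y a = 0); last first.
  apply/ltnW/pb => //.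
    rewrite -(frame_coll _ fr) => /(_ l l' z lX l'X zX)/eqP.
    rewrite /det yl yl' !subr0 mul0r subr0 mulf_eq0 (gt_eqF z0) orbF subr_eq0 => /eqP e.
    by move: ll'; rewrite (frame_inj fr (esym e)) ?eqxx // yl yl'.
  move=> a b aA bB; apply: h => //; apply/orP; left.
  rewrite lt_neqAle y_ge0 ?inE ?aA // andbT eq_sym.
  by apply/eqP => e; apply: na; exists a.
have [eb|nb] := pselect (exists2 b, b \in B & y b = 0).
  by apply: (lb x y) => //; exists z.
apply/ltnW/pb => //.
  rewrite -(frame_coll _ fr) => /(_ l l' z lX l'X zX)/eqP.
  rewrite /det yl yl' !subr0 mul0r subr0 mulf_eq0 (gt_eqF z0) orbF subr_eq0 => /eqP e.
  by move: ll'; rewrite (frame_inj fr (esym e)) ?eqxx // yl yl'.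
move=> a b aA bB; apply: h => //; apply/orP; right.
rewrite lt_neqAle y_ge0 ?inE ?bB ?orbT // andbT eq_sym.
by apply/eqP => e; apply: nb; exists b.
Qed.

(** A line through the point [q] of the axis separates the balanced initial segment [D] from the
    rest. A fan to one colour of [D] is blocked strictly on one side, and [half_bound] counts the
    other side; removing [D] lowers both classes by the same amount. *)
Lemma peel_bound n : line_bound n -> plane_bound n ->
  forall (x y : T -> R) A B C D (q : R) l l' z,
  frame x y -> [disjoint A & B] -> (#|A| + #|B| <= n.+1)%N ->
  (forall i, i \in A :|: B -> 0 <= y i) ->
  (forall i, i \in D -> [/\ i \in A :|: B, y i = 0 & x i < q]) ->
  (forall i, i \in A :|: B -> y i = 0 -> i \notin D -> q < x i) ->
  D != set0 -> #|A :&: D| = #|B :&: D| ->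
  l \in (A :|: B) :\: D -> l' \in (A :|: B) :\: D -> l != l' -> y l = 0 -> y l' = 0 ->
  z \in A :|: B -> 0 < y z ->
  hits_off y A B C -> (minn #|A| #|B| <= #|C|)%N.
Proof.
move=> lb pb x y A B C D q l l' z fr dAB sz y_ge0 DP nDP Dn eD lX l'X ll' yl yl' zX z0 h.
pose Z := [set i in A :|: B | 0 < y i].
have Zn : Z != set0 by apply/set0Pn; exists z; rewrite inE zX.
(* The first point met when a line rotates about the point [q] of the axis: the line [F = 0] through
   it leaves every point outside [D] on the side [F >= 0]. *)
have [z1 z1Z z1P] := arg_min_exists (fun i => (x i - q) / y i) Zn.
have [z1X z10] : z1 \in A :|: B /\ 0 < y z1 by move: z1Z; rewrite inE => /andP.
pose F w := x w - q - (x z1 - q) / y z1 * y w.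
have aF : aff F.
  by apply: (frame_aff (p := 1) (q := - ((x z1 - q) / y z1)) (r := - q) fr) => w; rewrite /F; ring.
have Fz1 : F z1 = 0 by rewrite /F divfK ?subrr // gt_eqF.
have Fge i : i \in (A :|: B) :\: D -> 0 <= F i.
  rewrite inE => /andP[iD iX]; have := y_ge0 i iX; rewrite le_eqVlt => /orP[/eqP e|i0].
    by have := nDP i iX (esym e) iD; rewrite /F -e; lra.
  have iZ : i \in Z by rewrite inE iX.
  by have := z1P i iZ; rewrite ler_pdivlMr // /F subr_ge0.
have FD i : i \in D -> F i < 0 by case/DP=> _ e; rewrite /F e; lra.
have yD i : i \in D -> y i = 0 by case/DP.
(* The fan goes from [z1] to the points of [D] of the other colour; as [D] is balanced, the colour
   of [z1] does not affect the count. *)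
have h1 : (#|B :&: D| <= #|setneg F C|)%N.
  have [z1A|z1B] := setUP z1X.
    apply: (fan_bound fr z10) => s; rewrite inE => /andP[sB sD]; first exact: yD.
    have [|c cC sg] := h z1 s z1A sB; first by rewrite z10.
    exists c => //; rewrite in_sign cC /=; apply: (aff_seg_lt aF (seg_sym sg)); first exact: FD.
    by rewrite Fz1.
  rewrite -eD; apply: (fan_bound fr z10) => s; rewrite inE => /andP[sA sD]; first exact: yD.
  have [|c cC sg] := h s z1 sA z1B; first by rewrite z10 orbT.
  exists c; last exact: seg_sym.
  rewrite in_sign cC /=; apply: (aff_seg_lt aF sg); first exact: FD.
  by rewrite Fz1.
have h2 : (minn #|A :\: D| #|B :\: D| <= #|setge F C|)%N.
  apply: (half_bound lb pb (l := l) (l' := l') (z := z) fr); rewrite -?setDUl //.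
  - apply: disjointWl (subsetDl _ _) _; apply: disjointWr (subsetDl _ _) _; exact: dAB.
  - have : (0 < #|(A :&: D) :|: (B :&: D)|)%N.
      have /set0Pn[i iD] := Dn; apply/card_gt0P; exists i.
      by rewrite -setIUl inE iD andbT; case: (DP i iD).
    have [+ _] := leq_card_setU (A :&: D) (B :&: D).
    move: sz eD (cardsID D A) (cardsID D B); card_lia.
  - by move=> i; rewrite inE => /andP[_]; exact: y_ge0.
  - rewrite inE zX andbT; apply/negP => /yD e; by rewrite e ltxx in z0.
  - move=> a b aA bB ab; have [||c cC sg] := h a b _ _ ab.
    + by move: aA; rewrite inE => /andP[].
    + by move: bB; rewrite inE => /andP[].
    exists c => //; rewrite in_sign cC /=; apply: (aff_seg_ge aF sg); apply: Fge.
      by move: aA; rewrite !inE => /andP[-> ->].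
    by move: bB; rewrite !inE => /andP[-> ->]; rewrite orbT.
move: h1 h2 eD (card_neg_ge F C) (cardsID D A) (cardsID D B); card_lia.
Qed.

(** A line through the point [q] of the axis cuts off [a], [a'] and a set [D] in which [B] leads by
    one, so [A] leads by one in the part cut off. The strict inequality of [plane_bound] there
    yields as many blockers as this part has points of [A], the larger class, and [half_bound]
    handles the other side. *)
Lemma cut_bound n : line_bound n -> plane_bound n ->
  forall (x y : T -> R) A B C (q : R) a a' l l',
  frame x y -> [disjoint A & B] -> (#|A| + #|B| <= n.+1)%N ->
  (forall i, i \in A :|: B -> 0 <= y i) ->
  a \in A -> a' \in A -> a != a' -> y a = 0 -> y a' = 0 -> x a < q -> x a' < q ->
  (forall i, i \in A :|: B -> y i = 0 -> i != a -> i != a' -> q < x i) ->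
  l \in A :|: B -> l' \in A :|: B -> l != l' -> y l = 0 -> y l' = 0 ->
  q < x l -> q < x l' ->
  {in setpos y (A :|: B) &, injective (fun i => (x i - q) / y i)} ->
  (#|setpos y A| + 2 <= #|setpos y B|)%N ->
  hits_off y A B C -> (minn #|A| #|B| <= #|C|)%N.
Proof.
move=> lb pb x y A B C q a a' l l' fr dAB sz y_ge0 aA a'A aa' ya ya' xa xa' xL
  lX l'X ll' yl yl' ql ql' finj eZ h.
set f := fun i => (x i - q) / y i in finj.
have cU S : S \subset A :|: B -> S :&: setpos y (A :|: B) = setpos y S.
  move=> sub; apply/setP => i; rewrite inE !in_sign; case: (boolP (i \in S)) => //= iS.
  by rewrite (subsetP sub).
(* The colours are exchanged: [B] leads by exactly one in [D]. Its lead of two over all points off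
   the axis then leaves such a point outside [D]. *)
have [||||D [DZ eD Dlt]] := @downset_excess R T f B A (setpos y (A :|: B)) 1.
- by rewrite disjoint_sym.
- by apply/subsetP => i; rewrite in_sign setUC => /andP[].
- exact: finj.
- by rewrite !cU ?subsetUl ?subsetUr //; move: eZ; card_lia.
have DP i : i \in D -> i \in A :|: B /\ 0 < y i.
  by move=> /(subsetP DZ); rewrite in_sign => /andP.
have Dn : D != set0.
  by apply: contraTneq isT => D0; move: eD; rewrite D0 !setI0 !cards0.
have D'n : setpos y (A :|: B) :\: D != set0.
  apply: contraTneq isT => /eqP; rewrite setD_eq0 => ZD.
  have e : D = setpos y (A :|: B) by apply/eqP; rewrite eqEsubset DZ ZD.
  by move: eD eZ; rewrite e !cU ?subsetUl ?subsetUr //; card_lia.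
have [u [v [uv Du Dv]]] := exists_between Dn D'n Dlt.
(* Strictly between the ratios of [D] and those of the remaining points off the axis, so no coloured
   point lies on [F = 0]. *)
pose t := (u + v) / 2.
pose F w := x w - q - t * y w.
have aF : aff F.
  by apply: (frame_aff (p := 1) (q := - t) (r := - q) fr) => w; rewrite /F; ring.
have FD i : i \in D -> F i < 0.
  move=> iD; have [iX i0] := DP i iD; have := Du i iD.
  rewrite /f ler_pdivrMr // /F /t => ?; nra.
have FD' i : i \in A :|: B -> 0 < y i -> i \notin D -> 0 < F i.
  move=> iX i0 iD; have := Dv i; rewrite inE iD in_sign iX i0 => /(_ isT).
  rewrite /f ler_pdivlMr // /F /t => ?; nra.
have FL i : y i = 0 -> F i = x i - q by rewrite /F => ->; ring.
have FX i : i \in A :|: B -> i \notin D -> i != a -> i != a' -> 0 < F i.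
  move=> iX iD ia ia'; have := y_ge0 i iX; rewrite le_eqVlt => /orP[/eqP e|i0]; last exact: FD'.
  by rewrite FL // subr_gt0 xL.
have yD i : i \in D -> y i != 0 by case/DP => _ /gt_eqF ->.
have aD : a \notin D by apply/negP => /yD; rewrite ya eqxx.
have a'D : a' \notin D by apply/negP => /yD; rewrite ya' eqxx.
have nB i : i \in A -> i \in B -> False.
  by move=> iA iB; move: (disjointFr dAB iA); rewrite iB.
have F0 i : i \in A :|: B -> F i != 0.
  move=> iX; have [/FD/lt_eqF -> //|iD] := boolP (i \in D).
  have [->|ia] := eqVneq i a; first by rewrite FL // subr_eq0 lt_eqF.
  have [->|ia'] := eqVneq i a'; first by rewrite FL // subr_eq0 lt_eqF.
  by rewrite gt_eqF ?FX.
have z0 S : S \subset A :|: B -> setzero F S = set0.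
  move=> sub; apply/setP => i; rewrite in_sign inE; apply/negP => /andP[/(subsetP sub)].
  by move=> /F0 /negPf ->.
have cA : #|A| = (#|setneg F A| + #|setpos F A|)%N.
  by rewrite (card_sign F A) z0 ?subsetUl // cards0 addn0.
have cB : #|B| = (#|setneg F B| + #|setpos F B|)%N.
  by rewrite (card_sign F B) z0 ?subsetUr // cards0 addn0.
have nA : #|setneg F A| = (#|A :&: D| + 2)%N.
  have -> : setneg F A = (A :&: D) :|: [set a; a'].
    apply/setP => i; rewrite in_sign !inE.
    have [->|ia] := eqVneq i a; first by rewrite aA FL // subr_lt0 xa orbT.
    have [->|ia'] := eqVneq i a'; first by rewrite a'A FL // subr_lt0 xa' !orbT.
    rewrite orbF; case: (boolP (i \in A)) => //= iA.
    have [/FD//|iD] := boolP (i \in D).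
    by rewrite ltNge ltW // FX // inE iA.
  rewrite cardsU cards2 aa' (_ : _ :&: [set a; a'] = set0) ?cards0 ?subn0 //.
  apply/setP => i; rewrite !inE; apply/negP => /andP[/andP[_ iD]] /orP[] /eqP e.
    by rewrite -e iD in aD.
  by rewrite -e iD in a'D.
have nBe : #|setneg F B| = #|B :&: D|.
  congr #|pred_of_set _|; apply/setP => i; rewrite in_sign !inE.
  case: (boolP (i \in B)) => //= iB; have [/FD//|iD] := boolP (i \in D).
  rewrite ltNge ltW // FX ?inE ?iB ?orbT //.
    by apply/eqP => e; apply: (nB i) => //; rewrite e.
  by apply/eqP => e; apply: (nB i) => //; rewrite e.
have subA P : [set i in A | P i] \subset A by apply/subsetP => i; rewrite inE => /andP[].
have subB P : [set i in B | P i] \subset B by apply/subsetP => i; rewrite inE => /andP[].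
have h1 : (minn #|setneg F A| #|setneg F B| < #|setneg F C|)%N.
  apply: pb.
  - by apply: disjointWl (subA _) _; apply: disjointWr (subB _) _.
  - have : (0 < #|setpos F A| + #|setpos F B|)%N.
      rewrite addn_gt0 !card_gt0; apply/orP.
      have Fl : 0 < F l by rewrite FL // subr_gt0.
      by have [lA|lB] := setUP lX; [left|right]; apply/set0Pn; exists l; rewrite in_sign ?lA ?lB.
    by move: sz cA cB; card_lia.
  - by rewrite -card_gt0 nA addn2.
  - by rewrite -card_gt0 nBe eD addn1.
  - have [d dD] := set0Pn _ Dn; have [dX d0] := DP d dD.
    have inN i : i \in A :|: B -> F i < 0 -> i \in setneg F A :|: setneg F B.
      by rewrite !inE -andb_orl => -> ->.
    have aN : a \in setneg F A :|: setneg F B by rewrite inN ?inE ?aA // FL // subr_lt0.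
    have a'N : a' \in setneg F A :|: setneg F B by rewrite inN ?inE ?a'A // FL // subr_lt0.
    rewrite -(frame_coll _ fr) => /(_ a a' d aN a'N (inN d dX (FD d dD)))/eqP.
    rewrite /det ya ya' !subr0 mul0r subr0 mulf_eq0 (gt_eqF d0) orbF subr_eq0 => /eqP e.
    by move: aa'; rewrite (frame_inj fr (esym e)) ?eqxx // ya ya'.
  - move=> i j; rewrite !in_sign => /andP[iA Fi] /andP[jB Fj].
    (* The only axis points cut off are [a] and [a'], both in [A]; hence [j] is in [D], off the
       axis, and the pair is not exempt. *)
    have [|c cC sg] := h i j iA jB.
      have jX : j \in A :|: B by rewrite inE jB orbT.
      have [jD|jD] := boolP (j \in D); first by case: (DP j jD) => _ ->; rewrite orbT.
      have := FX j jX jD; rewrite ltNge (ltW Fj) => jF.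
      have [ja|ja] := eqVneq j a; first by case: (nB j); rewrite // ja.
      have [ja'|ja'] := eqVneq j a'; first by case: (nB j); rewrite // ja'.
      by have := jF ja ja'.
    exists c => //; rewrite in_sign cC /=; apply: (aff_seg_lt aF sg) => //; exact: ltW.
have h2 : (minn #|setpos F A| #|setpos F B| <= #|setpos F C|)%N.
  have [w wZ] := set0Pn _ D'n.
  have [wX w0 wD] : [/\ w \in A :|: B, 0 < y w & w \notin D].
    by move: wZ; rewrite inE in_sign => /and3P[? ? ?].
  have inU i : (i \in setpos F A :|: setpos F B) = (i \in A :|: B) && (0 < F i).
    by rewrite !inE andb_orl.
  apply: (half_bound lb pb (l := l) (l' := l') (z := w) fr).
  - by apply: disjointWl (subA _) _; apply: disjointWr (subB _) _.
  - by move: sz cA cB nA; card_lia.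
  - by move=> i; rewrite inU => /andP[/y_ge0].
  - by rewrite inU lX FL // subr_gt0.
  - by rewrite inU l'X FL // subr_gt0.
  - by [].
  - by [].
  - by [].
  - by rewrite inU wX FD'.
  - by [].
  - move=> i j; rewrite !in_sign => /andP[iA Fi] /andP[jB Fj] ij.
    have [c cC sg] := h i j iA jB ij; exists c => //.
    rewrite in_sign cC /=; apply: (aff_seg_gt aF sg) => //; exact: ltW.
move: h1 h2 cA cB nA nBe eD (card_sign F C); card_lia.
Qed.

(** The points off the axis lie on a second line [M = 0]. The strip bound between axis points off
    that line and points on it gives blockers off [M = 0], and a blocker of [za] and [zb] on it
    makes up for the lost one. *)
Lemma coll_bound (x y : T -> R) A B C : frame x y -> [disjoint A & B] ->
  (forall i, i \in A :|: B -> 0 <= y i) ->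
  (0 < #|setzero y B| <= #|setzero y A|)%N ->
  setpos y A != set0 -> setpos y B != set0 -> coll (setpos y (A :|: B)) ->
  hits_off y A B C -> (minn #|A| #|B| <= #|C|)%N.
Proof.
move=> fr dAB y_ge0 /andP[b0 ab] /set0Pn[za] + /set0Pn[zb] + cZ h.
rewrite !in_sign => /andP[zaA za0] /andP[zbB zb0].
have zne : za <> zb.
  by move=> e; move: (disjointFr dAB zaA); rewrite e zbB.
have zZ S i : S \subset A :|: B -> i \in setpos y S -> i \in setpos y (A :|: B).
  by move=> sub; rewrite !in_sign => /andP[/(subsetP sub) -> ->].
have zaZ : za \in setpos y (A :|: B) by rewrite in_sign inE zaA.
have zbZ : zb \in setpos y (A :|: B) by rewrite in_sign inE zbB orbT.
have dZ i j k : i \in setpos y (A :|: B) -> j \in setpos y (A :|: B) ->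
    k \in setpos y (A :|: B) -> det x y i j k = 0.
  by apply: (frame_coll _ fr).2.
pose M := det x y za zb.
have aM : aff M by exact: det_aff.
have M1 l l' : y l = 0 -> y l' = 0 -> M l = 0 -> M l' = 0 -> l = l'.
  move=> yl yl' ml ml'; have mz : M za = 0 by exact: dZ.
  have /eqP := det_line fr zne ml ml' mz.
  rewrite /det yl yl' !subr0 mul0r subr0 mulf_eq0 (gt_eqF za0) orbF subr_eq0 => /eqP e.
  by apply: (frame_inj fr) => //; rewrite yl yl'.
have injM l b b' : y l = 0 -> M l != 0 -> b \in setpos y (A :|: B) ->
    b' \in setpos y (A :|: B) -> det x y l b b' = 0 -> b = b'.
  move=> yl ml bZ b'Z d0; apply/eqP; apply: contraNT ml => /eqP bb'.
  apply/eqP/(det_line fr bb'); [exact: dZ|exact: dZ|].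
  by rewrite -d0 /det; ring.
have c0 : (0 < #|setzero M C|)%N.
  have [|c cC sg] := h za zb zaA zbB; first by rewrite za0.
  apply/card_gt0P; exists c; rewrite in_sign cC /=; apply/eqP.
  by apply: (aff_seg_eq aM sg); exact: dZ.
have strip S (Q : {set T}) : S \subset A :|: B -> Q \subset A :|: B ->
    hits_off y S Q C -> (forall l, l \in setzero y S -> M l != 0) ->
    setzero y S != set0 -> setpos y Q != set0 ->
    (#|setzero y S| + #|setpos y Q| <= #|C|)%N.
  move=> sS sQ hS ml Sn Qn.
  have : (#|setzero y S| + #|setpos y Q| <= #|C :\: setzero M C|.+1)%N.
    apply: (strip_bound fr) => //.
    - by move=> i; rewrite in_sign => /andP[_ /eqP].
    - by move=> i; rewrite in_sign => /andP[].
    - move=> l b b' lS bQ b'Q; apply: injM; [|exact: ml|exact: zZ bQ|exact: zZ b'Q].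
      by move: lS; rewrite in_sign => /andP[_ /eqP].
    - move=> l b lS bQ.
      have [lS' yl] : l \in S /\ y l = 0 by move: lS; rewrite in_sign => /andP[? /eqP].
      have [bQ' yb] : b \in Q /\ 0 < y b by move: bQ; rewrite in_sign => /andP.
      have [|c cC sg] := hS l b lS' bQ'; first by rewrite yb orbT.
      exists c => //; rewrite inE cC in_sign cC /= andbT.
      apply: contra (ml l lS) => /eqP mc; apply/eqP.
      apply: (aff_seg_eq0 aM (seg_sym sg)) => //; apply: dZ => //; exact: zZ bQ.
  move: c0 (cardsID (setzero M C) C).
  rewrite (setIidPr _); last by apply/subsetP => c; rewrite in_sign => /andP[].
  card_lia.
have cA : #|A| = (#|setzero y A| + #|setpos y A|)%N.
  by apply: card_zero_pos => i iA; apply: y_ge0; rewrite inE iA.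
have cB : #|B| = (#|setzero y B| + #|setpos y B|)%N.
  by apply: card_zero_pos => i iB; apply: y_ge0; rewrite inE iB orbT.
have BZn : setpos y B != set0 by apply/set0Pn; exists zb; rewrite in_sign zbB.
have AZn : setpos y A != set0 by apply/set0Pn; exists za; rewrite in_sign zaA.
have BLn : setzero y B != set0 by rewrite -card_gt0.
have ALn : setzero y A != set0 by rewrite -card_gt0 (leq_trans b0).
have [[p pA mp]|np] := pselect (exists2 p, p \in setzero y A & M p = 0); last first.
  have ml l : l \in setzero y A -> M l != 0.
    by move=> lA; apply/eqP => e; apply: np; exists l.
  have := strip A B (subsetUl _ _) (subsetUr _ _) h ml ALn BZn.
  by move: ab cA cB; card_lia.
have [pA' yp] : p \in A /\ y p = 0 by move: pA; rewrite in_sign => /andP[? /eqP].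
have [lt|le] := ltnP #|setzero y B| #|setzero y A|.
  have e : setzero y (A :\ p) = setzero y A :\ p.
    by apply/setP => i; rewrite !inE andbA.
  have sub : A :\ p \subset A by exact: subsetDl.
  have hp : hits_off y (A :\ p) B C.
    by move=> i j iA; apply: h; exact: (subsetP sub).
  have ml l : l \in setzero y (A :\ p) -> M l != 0.
    rewrite !inE => /andP[/andP[lp lA] /eqP yl]; apply/eqP => ml.
    by move: lp; rewrite (M1 l p) ?eqxx.
  have nz : setzero y (A :\ p) != set0.
    by rewrite e -card_gt0; move: lt b0; rewrite (cardsD1 p (setzero y A)) pA /=; card_lia.
  have := strip (A :\ p) B (subset_trans sub (subsetUl _ _)) (subsetUr _ _) hp ml nz BZn.
  rewrite e.
  by move: lt cA cB; rewrite (cardsD1 p (setzero y A)) pA /=; card_lia.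
have ml l : l \in setzero y B -> M l != 0.
  rewrite in_sign => /andP[lB /eqP yl]; apply/eqP => ml.
  by move: (disjointFr dAB pA'); rewrite -(M1 l p) ?lB.
have := strip B A (subsetUr _ _) (subsetUl _ _) (hits_off_sym h) ml BLn AZn.
by move: ab le cA cB; card_lia.
Qed.

Lemma line_step_major n : line_bound n -> plane_bound n ->
  forall (x y : T -> R) A B C,
  frame x y -> [disjoint A & B] -> (#|A| + #|B| <= n.+1)%N ->
  (forall i, i \in A :|: B -> 0 <= y i) ->
  (0 < #|setzero y B| <= #|setzero y A|)%N ->
  (exists2 z, z \in A :|: B & 0 < y z) ->
  hits_off y A B C -> (minn #|A| #|B| <= #|C|)%N.
Proof.
move=> lb pb x y A B C fr dAB sz y_ge0 bL [z zX z0] h.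
have /andP[b0 ab] := bL.
have cA : #|A| = (#|setzero y A| + #|setpos y A|)%N.
  by apply: card_zero_pos => i iA; apply: y_ge0; rewrite inE iA.
have cB : #|B| = (#|setzero y B| + #|setpos y B|)%N.
  by apply: card_zero_pos => i iB; apply: y_ge0; rewrite inE iB orbT.
have yz S i : i \in setzero y S -> y i = 0 by rewrite in_sign => /andP[_ /eqP].
have szS S i : i \in setzero y S -> i \in S by rewrite in_sign => /andP[].
have pos_in S i : i \in setpos y S -> i \in S /\ 0 < y i by rewrite in_sign => /andP.
(* If one colour lies entirely on the axis, a single fan from [z] reaches all of it. *)
have [BZ0|BZn] := eqVneq (setpos y B) set0.
  have zA : z \in A.
    have [//|zB] := setUP zX; have : z \in setpos y B by rewrite in_sign zB.
    by rewrite BZ0 inE.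
  rewrite geq_min cB BZ0 cards0 addn0; apply/orP; right.
  apply: (fan_bound fr z0) => s sB; first exact: yz sB.
  by apply: h => //; [exact: szS sB | rewrite z0].
have [AZ0|AZn] := eqVneq (setpos y A) set0.
  have zB : z \in B.
    have [zA|//] := setUP zX; have : z \in setpos y A by rewrite in_sign zA.
    by rewrite AZ0 inE.
  rewrite geq_min cA AZ0 cards0 addn0; apply/orP; left.
  apply: (fan_bound fr z0) => s sA; first exact: yz sA.
  by apply: (hits_off_sym h) => //; [exact: szS sA | rewrite z0].
have [cZ|ncZ] := pselect (coll (setpos y (A :|: B))).
  exact: (coll_bound fr dAB y_ge0 bL).
have posU : setpos y (A :|: B) = setpos y A :|: setpos y B.
  by apply/setP => i; rewrite !inE andb_orl.
have Zn : setpos y (A :|: B) != set0 by apply/set0Pn; exists z; rewrite in_sign zX.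
have [z1 z1Z z1P] := arg_min_exists y Zn.
have [z1X z10] := pos_in _ _ z1Z.
(* Separate at the height of a lowest point [z1] off the axis: its fan is blocked strictly below,
   pairs off the axis at this height or above. *)
have low : (#|setzero y B| + minn #|setpos y A| #|setpos y B| < #|C|)%N.
  pose F w := y w - y z1.
  have aF : aff F.
    by apply: (frame_aff (p := 0) (q := 1) (r := - y z1) fr) => w; rewrite /F; ring.
  have h1 : (#|setzero y B| <= #|setneg F C|)%N.
    have [z1A|z1B] := setUP z1X.
      apply: (fan_bound fr z10) => s sB; first exact: yz sB.
      have [|c cC sg] := h z1 s z1A (szS _ _ sB); first by rewrite z10.
      exists c => //; rewrite in_sign cC /=; apply: (aff_seg_lt aF (seg_sym sg)).
        by rewrite /F (yz _ _ sB) sub0r oppr_lt0.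
      by rewrite /F subrr.
    apply: leq_trans ab _; apply: (fan_bound fr z10) => s sA; first exact: yz sA.
    have [|c cC sg] := h s z1 (szS _ _ sA) z1B; first by rewrite z10 orbT.
    exists c; last exact: seg_sym.
    rewrite in_sign cC /=; apply: (aff_seg_lt aF sg).
      by rewrite /F (yz _ _ sA) sub0r oppr_lt0.
    by rewrite /F subrr.
  have h2 : (minn #|setpos y A| #|setpos y B| < #|setge F C|)%N.
    apply: pb => //.
    - apply: disjointWl (_ : _ \subset A) _; first by apply/subsetP => i /pos_in[].
      by apply: disjointWr dAB; apply/subsetP => i /pos_in[].
    - have : (0 < #|setzero y B|)%N by [].
      by move: sz cA cB; card_lia.
    - by rewrite -posU.
    - move=> a b aA bB; have [aA' a0] := pos_in _ _ aA; have [bB' _] := pos_in _ _ bB.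
      have [|c cC sg] := h a b aA' bB'; first by rewrite a0.
      exists c => //; rewrite in_sign cC /=; apply: (aff_seg_ge aF sg); rewrite /F subr_ge0.
        by apply: z1P; rewrite posU inE aA.
      by apply: z1P; rewrite posU inE bB orbT.
  by move: h1 h2 (card_neg_ge F C); card_lia.
have [done|more] := leqP (minn #|A| #|B|) #|C|; first by [].
(* Failure of the bound against [low] forces both leads of at least two, which the remaining cases
   use. *)
have eL : (#|setzero y B| + 2 <= #|setzero y A|)%N by move: low more cA cB ab; card_lia.
have eZ : (#|setpos y A| + 2 <= #|setpos y B|)%N by move: low more cA cB ab; card_lia.
suff : (minn #|A| #|B| <= #|C|)%N by move: more; card_lia.
clear more.
have LU : setzero y (A :|: B) = setzero y A :|: setzero y B.
  by apply/setP => i; rewrite !inE andb_orl.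
pose L := setzero y (A :|: B).
have xL : {in L &, injective x}.
  by move=> i j iL jL e; apply: (frame_inj fr) => //; rewrite (yz _ _ iL) (yz _ _ jL).
have cAL D : D \subset L -> A :&: (L :\: D) = setzero y A :\: D.
  move=> DL; apply/setP => i; rewrite !inE.
  by case: (i \in A) => //=; rewrite ?andbF ?andbT.
have cBL D : D \subset L -> B :&: (L :\: D) = setzero y B :\: D.
  move=> DL; apply/setP => i; rewrite !inE.
  by case: (i \in B) => //=; rewrite ?andbF ?andbT ?orbT.
have [a0 a0A] : exists a0, a0 \in setzero y A by apply/card_gt0P; move: eL; card_lia.
have [b1 b1B] : exists b1, b1 \in setzero y B by apply/card_gt0P.
have Ln : L != set0 by apply/set0Pn; exists a0; rewrite /L LU inE a0A.
have nAB i : i \in A -> i \in B -> False.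
  by move=> iA iB; move: (disjointFr dAB iA); rewrite iB.
have peel D : D \subset L -> D != set0 -> #|A :&: D| = #|B :&: D| ->
    (forall s s', s \in D -> s' \in L :\: D -> x s < x s') -> (minn #|A| #|B| <= #|C|)%N.
  move=> DL Dn eD lt.
  have AD : setzero y A :&: D = A :&: D.
    apply/setP => i; rewrite !inE; case: (boolP (i \in D)) => [/(subsetP DL)/yz ->|]; rewrite ?andbF //.
    by rewrite eqxx !andbT.
  have BD : setzero y B :&: D = B :&: D.
    apply/setP => i; rewrite !inE; case: (boolP (i \in D)) => [/(subsetP DL)/yz ->|]; rewrite ?andbF //.
    by rewrite eqxx !andbT.
  (* A balanced [D] leaves the lead of [A] on the axis intact, and this supplies the two axis points
     that [peel_bound] needs outside [D]. *)
  have two : (1 < #|setzero y A :\: D|)%N.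
    move: eL eD (cardsID D (setzero y A)) (cardsID D (setzero y B)); rewrite AD BD.
    by card_lia.
  have /card_gt1P[l [l' [lA l'A ll']]] := two.
  have inL i : i \in setzero y A :\: D -> i \in L :\: D.
    by rewrite !in_setD /L LU in_setU => /andP[-> ->].
  have LX i : i \in L :\: D -> i \in (A :|: B) :\: D.
    by rewrite !in_setD in_sign => /andP[-> /andP[->]].
  have Ly i : i \in L :\: D -> y i = 0 by rewrite inE => /andP[_ /yz].
  have D'n : L :\: D != set0 by apply/set0Pn; exists l; exact: inL.
  have [u [v [uv Du Dv]]] := exists_between Dn D'n lt.
  apply: (peel_bound lb pb (D := D) (q := (u + v) / 2) (l := l) (l' := l') (z := z) fr) => //.
  - move=> i iD; have iL := subsetP DL _ iD; split; [exact: szS iL|exact: yz iL|].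
    by have := Du i iD; lra.
  - move=> i iX yi iD; have := Dv i; rewrite inE iD in_sign iX yi eqxx => /(_ isT); lra.
  - exact/LX/inL.
  - exact/LX/inL.
  - exact/Ly/inL.
  - exact/Ly/inL.
have [x1 x1L x1P] := arg_min_exists x Ln.
have x1lt s : s \in L -> s != x1 -> x x1 < x s.
  move=> sL; apply: contraNT; rewrite -leNgt => le; apply/eqP/xL => //.
  by apply: le_anti; rewrite le x1P.
have [x1A|x1B] := setUP (szS _ _ x1L); last first.
  have s1 : [set x1] \subset L by rewrite sub1set.
  have x1A : x1 \notin setzero y A by apply/negP => /szS x1A; exact: (nAB x1).
  have x1B' : x1 \in setzero y B by rewrite in_sign x1B (yz _ _ x1L) eqxx.
  (* Beyond [x1], which is in [B], take an initial segment in which [A] leads by one; adding [x1]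
     balances it. *)
  have [||||D [DL eD lt]] := @downset_excess R T x A B (L :\ x1) 1.
  - exact: dAB.
  - by apply/subsetP => i; rewrite inE => /andP[_ /szS].
  - by move=> i j; rewrite !in_setD1 => /andP[_ iL] /andP[_ jL]; exact: xL.
  - rewrite cAL // cBL //; move: eL; rewrite (cardsD1 x1 (setzero y A)) (negPf x1A).
    by rewrite (cardsD1 x1 (setzero y B)) x1B'; card_lia.
  have x1D : x1 \notin D by apply/negP => /(subsetP DL); rewrite !inE eqxx.
  apply: (peel (x1 |: D)).
  - by rewrite subUset s1 (subset_trans DL) // subsetDl.
  - by apply/set0Pn; exists x1; rewrite setU11.
  - have -> : A :&: (x1 |: D) = A :&: D.
      apply/setP => i; rewrite !inE; have [->|//] := eqVneq i x1.
      by rewrite (negPf x1D) andbF; apply/negP => /andP[x1A' _]; exact: (nAB x1).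
    have -> : B :&: (x1 |: D) = x1 |: (B :&: D).
      by apply/setP => i; rewrite !inE; have [->|//] := eqVneq i x1; rewrite x1B.
    by rewrite eD cardsU1 inE (negPf x1D) andbF addnC.
  - move=> s s'; rewrite in_setU1 in_setD in_setU1 negb_or => + /andP[/andP[s'1 s'D] s'L].
    move=> /orP[/eqP ->|sD]; first exact: x1lt.
    by apply: lt => //; rewrite !in_setD s'D s'L in_set1 s'1.
have x1A' : x1 \in setzero y A by rewrite in_sign x1A (yz _ _ x1L) eqxx.
have L1n : L :\ x1 != set0.
  apply/set0Pn; exists b1; rewrite in_setD1 /L LU inE b1B orbT andbT.
  by apply/eqP => e; apply: (nAB x1) => //; rewrite -e; exact: szS b1B.
have [x2 + x2P] := arg_min_exists x L1n; rewrite in_setD1 => /andP[x21 x2L].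
have x2lt s : s \in L -> s != x1 -> s != x2 -> x x2 < x s.
  move=> sL s1; apply: contraNT; rewrite -leNgt => le; apply/eqP/xL => //.
  by apply: le_anti; rewrite le x2P // in_setD1 s1.
have s2 : [set x1; x2] \subset L by rewrite subUset !sub1set x1L.
have lt2 s s' : s \in [set x1; x2] -> s' \in L :\: [set x1; x2] -> x s < x s'.
  rewrite in_setD !in_set2 negb_or => + /andP[/andP[s'1 s'2] s'L].
  by move=> /orP[] /eqP ->; [exact: x1lt|exact: x2lt].
have two : [set x1; x2] != set0 by apply/set0Pn; exists x1; rewrite set21.
have [x2A|x2B] := setUP (szS _ _ x2L); last first.
  apply: (peel [set x1; x2]) => //.
  have -> : A :&: [set x1; x2] = [set x1].
    apply/setP => i; rewrite !inE; have [->|i1] /= := eqVneq i x1; first by rewrite x1A.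
    have [->|i2] := eqVneq i x2; last by rewrite andbF.
    by apply/negP => /andP[x2A _]; exact: (nAB x2).
  have -> : B :&: [set x1; x2] = [set x2].
    apply/setP => i; rewrite !inE; have [->|i2] /= := eqVneq i x2; first by rewrite x2B orbT.
    have [->|i1] := eqVneq i x1; last by rewrite andbF.
    by apply/negP => /andP[x1B _]; exact: (nAB x1).
  by rewrite !cards1.
(* [A] has at least three points on the axis, so [a1] and [b1] both lie beyond the first two. *)
have [a1 a1P] : exists a1, a1 \in setzero y A :\: [set x1; x2].
  apply/card_gt0P; move: eL b0 (cardsID [set x1; x2] (setzero y A)).
  have : (#|setzero y A :&: [set x1; x2]| <= #|[set x1; x2]|)%N by rewrite subset_leq_card ?subsetIr.
  by rewrite cards2; case: (_ == _); card_lia.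
have [a1A a11 a12] : [/\ a1 \in setzero y A, a1 != x1 & a1 != x2].
  by move: a1P; rewrite in_setD in_set2 negb_or => /andP[/andP[? ?] ?].
have a1L : a1 \in L by rewrite /L LU inE a1A.
have b1L : b1 \in L by rewrite /L LU inE b1B orbT.
have b11 : b1 != x1 by apply/eqP => e; apply: (nAB x1) => //; rewrite -e; exact: szS b1B.
have b12 : b1 != x2 by apply/eqP => e; apply: (nAB x2) => //; rewrite -e; exact: szS b1B.
have D'n : L :\: [set x1; x2] != set0.
  by apply/set0Pn; exists a1; rewrite in_setD in_set2 negb_or a11 a12.
have [u [v [uv Du Dv]]] := exists_between two D'n lt2.
(* Outside [bad], no two points off the line are collinear with the pivot [q]. *)
pose bad := [seq (x i * y j - x j * y i) / (y j - y i) | i <- enum T, j <- enum T].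
have [q /andP[uq qv] qbad] := exists_notin_seq bad uv.
have Lq i : i \in L -> i != x1 -> i != x2 -> q < x i.
  move=> iL i1 i2; apply: lt_le_trans qv _; apply: Dv.
  by rewrite in_setD in_set2 negb_or i1 i2.
apply: (cut_bound lb pb (q := q) (a := x1) (a' := x2) (l := a1) (l' := b1) fr) => //.
- by rewrite eq_sym.
- exact: yz x1L.
- exact: yz x2L.
- by apply: le_lt_trans uq; apply: Du; rewrite set21.
- by apply: le_lt_trans uq; apply: Du; rewrite set22.
- by move=> i iX yi; apply: Lq; rewrite in_sign iX yi eqxx.
- exact: szS a1L.
- exact: szS b1L.
- by apply/eqP => e; apply: (nAB a1); [exact: szS a1A|rewrite e; exact: szS b1B].
- exact: yz a1L.
- exact: yz b1L.
- exact: Lq.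
- exact: Lq.
move=> i j iZ jZ /= e; have [iX i0] := pos_in _ _ iZ; have [jX j0] := pos_in _ _ jZ.
have e' : q * (y j - y i) = x i * y j - x j * y i.
  have : (x i - q) * y j = (x j - q) * y i.
    by apply/eqP; rewrite -eqr_div ?lt0r_neq0 //; apply/eqP; exact: e.
  by move=> e'; nra.
have [yij|yij] := eqVneq (y j) (y i).
  move: e'; rewrite yij subrr mulr0 -mulrBl => /esym/eqP.
  rewrite mulf_eq0 (gt_eqF i0) orbF subr_eq0 => /eqP xij.
  by apply: (frame_inj fr).
case/negP: qbad; apply/allpairsP; exists (i, j); rewrite !mem_enum; split=> //=.
by rewrite -e' mulfK ?subr_eq0.
Qed.

Lemma line_step n : line_bound n -> plane_bound n -> line_bound n.+1.
Proof.
move=> lb pb x y A B C fr dAB sz y_ge0 [a aA ya] [b bB yb] zP h.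
have [le|/ltnW le] := leqP #|setzero y B| #|setzero y A|.
  apply: (line_step_major lb pb fr) => //; rewrite le andbT.
  by apply/card_gt0P; exists b; rewrite in_sign bB yb eqxx.
rewrite minnC; apply: (line_step_major lb pb fr) => //.
- by rewrite disjoint_sym.
- by rewrite addnC.
- by rewrite setUC.
- by rewrite le andbT; apply/card_gt0P; exists a; rewrite in_sign aA ya eqxx.
- by rewrite setUC.
- exact: hits_off_sym.
Qed.

(** As [p] is leftmost, the others are ordered by their slope [k] from [p]. The line bound for each
    closed side of a line through [p] and some [b] counts blockers strictly on that side; a blocker
    of [p] and [b] on the line gives strictness. *)
Lemma plane_bound_at n : line_bound n ->
  forall (x y : T -> R) A B C p,
  frame x y -> [disjoint A & B] -> (#|A| + #|B| <= n)%N -> B != set0 ->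
  p \in A -> (forall i, i \in A :|: B -> i != p -> x p < x i) ->
  ~ coll (A :|: B) -> hits A B C -> (minn #|A| #|B| < #|C|)%N.
Proof.
move=> lb x y A B C p fr dAB sz Bn pA xp ncX h.
pose k i := (y i - y p) / (x i - x p).
pose F b w := y w - y p - k b * (x w - x p).
have aF b : aff (F b).
  apply: (frame_aff (p := - k b) (q := 1) (r := k b * x p - y p) fr) => w.
  by rewrite /F; ring.
have Fp b : F b p = 0 by rewrite /F; ring.
have FE b i : i \in A :|: B -> i != p -> F b i = (k i - k b) * (x i - x p).
  move=> iX ip; have xi := xp i iX ip.
  by rewrite mulrBl divfK // subr_eq0 gt_eqF.
have Flt b i : i \in A :|: B -> i != p -> (F b i < 0) = (k i < k b).
  by move=> iX ip; rewrite FE // pmulr_llt0 ?subr_lt0 // subr_gt0 xp.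
have Fgt b i : i \in A :|: B -> i != p -> (0 < F b i) = (k b < k i).
  by move=> iX ip; rewrite FE // pmulr_lgt0 ?subr_gt0 // xp.
have BX i : i \in B -> i \in A :|: B by move=> iB; rewrite inE iB orbT.
have AX i : i \in A -> i \in A :|: B by move=> iA; rewrite inE iA.
have Bp i : i \in B -> i != p.
  by move=> iB; apply/eqP => e; move: (disjointFr dAB pA); rewrite -e iB.
pose le b S := (#|setneg (F b) S| + #|setzero (F b) S|)%N.
pose ge b S := (#|setzero (F b) S| + #|setpos (F b) S|)%N.
(* The line through [p] and [b] is chosen such that mixed minima, one colour on
   each side, still add up to at least the size of one of the classes. *)
have [b bB [b1 b2]] : exists2 b, b \in B & (#|setneg (F b) B| <= le b A)%N /\
    ((#|setneg (F b) A| <= le b B)%N \/ (#|setpos (F b) B| <= ge b A)%N).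
  (* If [G] is empty, the point of largest slope works, as no point of [B] is above it; otherwise
     the point of [G] of least slope does. *)
  pose G := [set b in B | #|setneg (F b) A| <= le b B]%N.
  have [G0|Gn] := eqVneq G set0.
    have [b bB bP] := arg_min_exists (fun i => - k i) Bn.
    have : b \notin G by rewrite G0 inE.
    rewrite inE bB /= -ltnNge => lt; exists b => //; split.
      by move: lt; rewrite /le; card_lia.
    right; rewrite (_ : setpos _ _ = set0) ?cards0 //.
    apply/setP => i; rewrite in_sign inE; apply/negP => /andP[iB].
    by rewrite Fgt ?BX ?Bp // ltNge -lerN2 bP.
  have [b bG bP] := arg_min_exists k Gn.
  have [bB bl] : b \in B /\ (#|setneg (F b) A| <= le b B)%N by move: bG; rewrite inE => /andP.
  exists b => //; split; last by left.
  have [->|Nn] := eqVneq (setneg (F b) B) set0; first by rewrite cards0.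
  (* The points of [B] strictly below [b] are at or below [b']. Since [b'] is not in [G], they are
     outnumbered by the points of [A] strictly below [b'], hence below [b]. *)
  have [b' + b'P] := arg_min_exists (fun i => - k i) Nn.
  rewrite in_sign => /andP[b'B]; rewrite Flt ?BX ?Bp // => b'b.
  have : b' \notin G by apply/negP => /bP; rewrite leNgt b'b.
  rewrite inE b'B /= -ltnNge => lt.
  have s1 : (#|setneg (F b) B| <= le b' B)%N.
    have := card_sign (F b') B; rewrite -/(le b' B) => cs.
    rewrite -(leq_add2r #|setpos (F b') B|) -cs -cardsUI.
    rewrite (_ : _ :&: _ = set0) ?cards0 ?addn0.
      by apply: subset_leq_card; apply/subsetP => i; rewrite inE !in_sign => /orP[] /andP[].
    apply/setP => i; rewrite !inE; apply/negP => /andP[/andP[iB fi] /andP[_ fi']].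
    have : i \in setneg (F b) B by rewrite in_sign iB.
    by move=> /b'P; rewrite lerN2 leNgt -Fgt ?BX ?Bp // fi'.
  have s2 : (#|setneg (F b') A| <= #|setneg (F b) A|)%N.
    apply: subset_leq_card; apply/subsetP => i; rewrite !in_sign => /andP[iA fi].
    have ip : i != p by apply: contraTneq fi => ->; rewrite Fp ltxx.
    by rewrite iA Flt ?AX //; apply: lt_trans b'b; rewrite -Flt ?AX.
  by move: lt s1 s2; rewrite /le; card_lia.
have Fb : F b b = 0 by rewrite FE ?BX ?Bp // subrr mul0r.
have A0 : (0 < #|setzero (F b) A|)%N.
  by apply/card_gt0P; exists p; rewrite in_sign pA Fp eqxx.
have B0 : (0 < #|setzero (F b) B|)%N.
  by apply/card_gt0P; exists b; rewrite in_sign bB Fb eqxx.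
have C0 : (0 < #|setzero (F b) C|)%N.
  have [c cC sg] := h p b pA bB; apply/card_gt0P; exists c; rewrite in_sign cC /=.
  by apply/eqP/(aff_seg_eq (aF b) sg).
(* Both sides at once: [s] is later taken to be [1] and [-1]. *)
have side (s : R) : s != 0 -> (exists2 z, z \in A :|: B & 0 < s * F b z) ->
    (minn #|setge (fun w => (s * F b w)%R) A| #|setge (fun w => (s * F b w)%R) B|
      <= #|setpos (fun w => (s * F b w)%R) C|)%N.
  move=> s0 [z zX z0]; set G := fun w => s * F b w.
  have frG : frame x G.
    apply: (frame_comb (p := 1) (q := 0) (r := 0) (p' := - s * k b) (q' := s)
      (r' := s * (k b * x p - y p)) fr); first by rewrite mul1r mul0r subr0.
    - by move=> i; ring.
    - by move=> i; rewrite /G /F; ring.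
  have inU i : (i \in setge G A :|: setge G B) = (i \in A :|: B) && (0 <= G i).
    by rewrite !inE andb_orl.
  apply: (lb x G) => //.
  - apply: disjointWl (_ : _ \subset A) _; first by apply/subsetP => i; rewrite inE => /andP[].
    by apply: disjointWr dAB; apply/subsetP => i; rewrite inE => /andP[].
  - by move: sz (card_neg_ge G A) (card_neg_ge G B); card_lia.
  - by move=> i; rewrite inU => /andP[].
  - by exists p; rewrite ?in_sign ?pA /G Fp mulr0 ?lexx.
  - by exists b; rewrite ?in_sign ?bB /G Fb mulr0 ?lexx.
  - by exists z; rewrite ?inU ?zX ?ltW.
  move=> i j; rewrite !in_sign => /andP[iA i0] /andP[jB j0] ij.
  have [c cC sg] := h i j iA jB; exists c => //; rewrite in_sign cC /=.
  have aG := frame_affy frG.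
  case/orP: ij => lt; first exact: aff_seg_gt sg _ _.
  by apply: (aff_seg_gt aG (seg_sym sg)).
have e1 S : (setpos (fun w => 1 * F b w) S = setpos (F b) S) *
    (setge (fun w => 1 * F b w) S = setge (F b) S).
  by split; apply/setP => i; rewrite !in_sign mul1r.
have eN S : (setpos (fun w => -1 * F b w) S = setneg (F b) S) *
    (setneg (fun w => -1 * F b w) S = setpos (F b) S).
  by split; apply/setP => i; rewrite !in_sign mulN1r ?oppr_gt0 ?oppr_lt0.
have cge S : #|setge (F b) S| = ge b S.
  by move: (card_sign (F b) S) (card_neg_ge (F b) S); rewrite /ge; card_lia.
have cle S : #|setge (fun w => (-1 * F b w)%R) S| = le b S.
  move: (card_sign (F b) S) (card_neg_ge (fun w => (-1 * F b w)%R) S); rewrite eN /le.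
  by card_lia.
have right : (exists2 z, z \in A :|: B & 0 < F b z) ->
    (minn (ge b A) (ge b B) <= #|setpos (F b) C|)%N.
  move=> [z zX z0]; have := side 1 (oner_neq0 _); rewrite !e1 !cge; apply.
  by exists z; rewrite ?mul1r.
have left : (exists2 z, z \in A :|: B & F b z < 0) ->
    (minn (le b A) (le b B) <= #|setneg (F b) C|)%N.
  move=> [z zX z0]; have := side (-1); rewrite oppr_eq0 oner_neq0 !eN !cle; apply=> //.
  by exists z; rewrite ?mulN1r ?oppr_gt0.
(* With one open side empty, the other closed side contains everything; with both empty, all points
   are collinear. *)
have [eR|nR] := pselect (exists2 z, z \in A :|: B & 0 < F b z).
  have [eL|nL] := pselect (exists2 z, z \in A :|: B & F b z < 0).
    move: (right eR) (left eL) b1 b2 A0 B0 C0.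
    move: (card_sign (F b) A) (card_sign (F b) B) (card_sign (F b) C).
    by rewrite /le /ge; card_lia.
  have z S : S \subset A :|: B -> setneg (F b) S = set0.
    move=> sub; apply/setP => i; rewrite in_sign inE; apply/negP => /andP[iS fi].
    by apply: nL; exists i => //; exact: (subsetP sub).
  move: (right eR) C0 (card_sign (F b) A) (card_sign (F b) B) (card_sign (F b) C).
  by rewrite (z A) ?subsetUl // (z B) ?subsetUr // !cards0 /ge; card_lia.
have z S : S \subset A :|: B -> setpos (F b) S = set0.
  move=> sub; apply/setP => i; rewrite in_sign inE; apply/negP => /andP[iS fi].
  by apply: nR; exists i => //; exact: (subsetP sub).
have [eL|nL] := pselect (exists2 z, z \in A :|: B & F b z < 0).
  move: (left eL) C0 (card_sign (F b) A) (card_sign (F b) B) (card_sign (F b) C).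
  by rewrite (z A) ?subsetUl // (z B) ?subsetUr // !cards0 /le; card_lia.
case: ncX; apply/(frame_coll _ fr) => i j l iX jX lX.
have yE w : w \in A :|: B -> y w = y p + k b * (x w - x p).
  move=> wX; have /eqP : F b w = 0.
    case: (ltgtP (F b w) 0) => // lt; first by case: nL; exists w.
    by case: nR; exists w.
  by rewrite /F subr_eq0 subr_eq => /eqP ->; rewrite addrC.
by rewrite /det (yE i iX) (yE j jX) (yE l lX); ring.
Qed.

Lemma plane_of_line n : line_bound n -> plane_bound n.
Proof.
move=> lb A B C dAB sz An Bn ncX h.
(* Outside these shears no two points share an abscissa, so the leftmost point is unique. *)
pose bad := [seq (x0 j - x0 i) / (y0 i - y0 j) | i <- enum T, j <- enum T].
have [t _ tbad] := exists_notin_seq bad (@ltr01 R).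
pose x i := x0 i + t * y0 i.
have xI : injective x.
  move=> i j e; have [yij|yij] := eqVneq (y0 i) (y0 j).
    by apply: coord_inj => //; move: e; rewrite /x yij => /addIr.
  case/negP: tbad; apply/allpairsP; exists (i, j); rewrite !mem_enum; split=> //=.
  have -> : x0 j - x0 i = t * (y0 i - y0 j) by move: e; rewrite /x => e; lra.
  by rewrite mulfK // subr_eq0.
have fr : frame x y0.
  apply: (frame_comb (p := 1) (q := t) (r := 0) (p' := 0) (q' := 1) (r' := 0) frame0).
  - by rewrite mulr0 subr0 mul1r oner_neq0.
  - by move=> i; rewrite /x; ring.
  - by move=> i; ring.
have Xn : A :|: B != set0.
  by apply: contraNneq An => /eqP; rewrite setU_eq0 => /andP[].
have [p pX pP] := arg_min_exists x Xn.
have plt i : i \in A :|: B -> i != p -> x p < x i.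
  move=> iX ip; rewrite lt_neqAle pP // andbT.
  by apply: contra ip => /eqP/xI ->.
have [pA|pB] := setUP pX; first exact: (plane_bound_at lb fr _ sz Bn pA).
rewrite minnC; apply: (plane_bound_at lb fr _ _ An pB).
- by rewrite disjoint_sym.
- by rewrite addnC.
- by rewrite setUC.
- by rewrite setUC.
- exact: hits_sym.
Qed.

(** The plane bound follows from the line bound at the same [n], so the induction runs on the line
    bound alone. *)
Lemma line_bound_all n : line_bound n.
Proof.
elim: n => [|n IH]; last exact: line_step (plane_of_line IH).
move=> x y A B C _ _ + _ [a aA _].
by rewrite leqn0 addn_eq0 cards_eq0 => /andP[/eqP A0 _]; rewrite A0 inE in aA.
Qed.

Lemma blocking_bound A B C : [disjoint A & B] -> A != set0 -> B != set0 ->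
  ~ coll (A :|: B) -> hits A B C -> (minn #|A| #|B| < #|C|)%N.
Proof. by move=> dAB; exact: (plane_of_line (@line_bound_all (#|A| + #|B|))). Qed.

(** * Degrees forced by a cut of the visibility graph *)

Lemma seg_neq a b : a != b -> ~ seg a b a.
Proof.
move=> ab [t /andP[t0 _] [ex ey]]; case/eqP: ab; apply: coord_inj.
  by have : t * (x0 a - x0 b) = 0 by [lra]; move=> /eqP; rewrite mulf_eq0 gt_eqF // subr_eq0 => /eqP.
by have : t * (y0 a - y0 b) = 0 by [lra]; move=> /eqP; rewrite mulf_eq0 gt_eqF // subr_eq0 => /eqP.
Qed.

Lemma seg_trans a b c d : seg a b c -> seg c b d -> seg a b d.
Proof.
move=> [t ti [ex ey]] [s si [ex' ey']].
exists (1 - (1 - t) * (1 - s)); first by nra.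
by rewrite ex' ey' ex ey; split; ring.
Qed.

Definition visible_rel (e : rel T) : Prop :=
  forall a b, e a b <-> a != b /\ forall c, ~ seg a b c.

(** A blocker outside [S] is coloured and can replace the end of its own colour. The open segment
    then contains fewer points, so this stops at a blocker in [S]. *)
Lemma hits_of_cut (e : rel T) A B S : visible_rel e -> [disjoint A & B] ->
  A :|: B = ~: S -> (forall a b, a \in A -> b \in B -> ~~ e a b) -> hits A B S.
Proof.
move=> vis dAB eS nAB a b.
elim: {a b}_.+1 {-2}a {-2}b (ltnSn #|[set c | `[< seg a b c >] ]|) => // m IH a b cm aA bB.
have ab i j : i \in A -> j \in B -> i != j.
  by move=> iA jB; apply/eqP => e'; move: (disjointFr dAB iA); rewrite e' jB.
have [c sc] : exists c, seg a b c.
  apply: contrapT => ns; move/negP: (nAB a b aA bB); apply; apply/vis; split; first exact: ab.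
  by move=> c sc; apply: ns; exists c.
have lt (i j : T) : (forall d, seg i j d -> seg a b d) -> ~ seg i j c ->
    (#|[set d | `[< seg i j d >] ]| < m)%N.
  move=> sub nc; rewrite ltnS in cm; apply: leq_trans (proper_card _) cm; apply/properP; split.
    by apply/subsetP => d; rewrite !inE => /asboolP/sub/asboolP.
  by exists c; rewrite inE; apply/asboolP.
have [cS|cS] := boolP (c \in S); first by exists c.
have : c \in A :|: B by rewrite eS inE.
rewrite inE => /orP[cA|cB].
  have sub d : seg c b d -> seg a b d by exact: seg_trans.
  have [|d dS sd] := IH c b (lt _ _ sub _) cA bB; first by apply: seg_neq; exact: ab.
  by exists d => //; exact: sub.
have sub d : seg a c d -> seg a b d.
  by move=> /seg_sym sd; apply/seg_sym/(seg_trans (seg_sym sc)).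
have [|d dS sd] := IH a c (lt _ _ sub _) aA cB.
  by move=> /seg_sym; apply: seg_neq; rewrite eq_sym; exact: ab.
by exists d => //; exact: sub.
Qed.

(** An extreme point [v] of the line sees at most one point [w] of [A :|: B]. If it sees one, then a
    point [c] of [S] on the same ray is hidden from it, which compensates for [w]. *)
Lemma coll_end_degree (e : rel T) A B S : visible_rel e -> [disjoint A & B] ->
  A :|: B = ~: S -> (forall a b, a \in A -> b \in B -> ~~ e a b) ->
  A != set0 -> B != set0 -> coll (A :|: B) ->
  exists2 v, v \in A :|: B & (#|[set w | e v w]| <= #|S|)%N.
Proof.
move=> vis + + + /set0Pn[a +] /set0Pn[b +].
move=> dAB eS nAB aA bB cX.
have hAB := hits_of_cut vis dAB eS nAB.
have ab : a <> b by move=> e'; move: (disjointFr dAB aA); rewrite e' bB.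
have fr := frame0.
pose M := det x0 y0 a b.
have aM : aff M by exact: det_aff.
have [aX bX] : a \in A :|: B /\ b \in A :|: B by rewrite !inE aA bB orbT.
have MX w : w \in A :|: B -> M w = 0 by move=> wX; exact: cX.
pose dx := x0 b - x0 a; pose dy := y0 b - y0 a.
(* Scalar product with the direction from [a] to [b]: it orders the points of the line, and [N] is
   the squared length of that direction. *)
pose g w := dx * x0 w + dy * y0 w.
have ag : aff g by exists dx, dy, 0 => w; rewrite /g; ring.
pose N := dx ^+ 2 + dy ^+ 2.
have N0 : N != 0.
  apply/eqP => /eqP; rewrite paddr_eq0 ?sqr_ge0 // !sqrf_eq0 !subr_eq0 => /andP[/eqP ex /eqP ey].
  by apply: ab; apply: coord_inj.
have gx v w : M v = 0 -> M w = 0 -> N * (x0 w - x0 v) = dx * (g w - g v).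
  rewrite /M /det -/dx -/dy /N /g => mv mw.
  have e' : dx * (y0 w - y0 v) = dy * (x0 w - x0 v) by lra.
  transitivity (dx ^+ 2 * (x0 w - x0 v) + dy * (dy * (x0 w - x0 v))); first by ring.
  by rewrite -e'; ring.
have gy v w : M v = 0 -> M w = 0 -> N * (y0 w - y0 v) = dy * (g w - g v).
  rewrite /M /det -/dx -/dy /N /g => mv mw.
  have e' : dx * (y0 w - y0 v) = dy * (x0 w - x0 v) by lra.
  transitivity (dx * (dx * (y0 w - y0 v)) + dy ^+ 2 * (y0 w - y0 v)); first by ring.
  by rewrite e'; ring.
have gI v w : M v = 0 -> M w = 0 -> g v = g w -> v = w.
  move=> mv mw e'; apply: coord_inj; apply/esym/eqP; rewrite -subr_eq0 -(mulrI_eq0 _ (mulfI N0)).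
    by rewrite gx // e' subrr mulr0.
  by rewrite gy // e' subrr mulr0.
have btw v c w : M v = 0 -> M c = 0 -> M w = 0 -> g v < g c -> g c < g w -> seg v w c.
  move=> mv mc mw vc cw; have vw : g w - g v != 0 by rewrite subr_eq0 gt_eqF // (lt_trans vc).
  have vw0 : 0 < g w - g v by lra.
  exists ((g c - g v) / (g w - g v)).
    apply/andP; split; first by rewrite divr_gt0 // subr_gt0.
    by rewrite ltr_pdivrMr // mul1r; lra.
  have tE : (g c - g v) / (g w - g v) * (g w - g v) = g c - g v by rewrite divfK.
  split; apply/eqP; rewrite -subr_eq0 -(mulrI_eq0 _ (mulfI N0)); apply/eqP.
    transitivity (N * (x0 c - x0 v) - (g c - g v) / (g w - g v) * (N * (x0 w - x0 v))); first by ring.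
    by rewrite !gx // mulrCA tE subrr.
  transitivity (N * (y0 c - y0 v) - (g c - g v) / (g w - g v) * (N * (y0 w - y0 v))); first by ring.
  by rewrite !gy // mulrCA tE subrr.
have Xn : A :|: B != set0 by apply/set0Pn; exists a.
have [v vX vP] := arg_min_exists g Xn; exists v => //.
have vlt w : w \in A :|: B -> w != v -> g v < g w.
  move=> wX wv; rewrite lt_neqAle vP // andbT.
  by apply: contra wv => /eqP/gI ->; rewrite ?MX.
have XS w : w \in A :|: B -> w \notin S by rewrite eS inE.
have [u uX [c cS sc]] : exists2 u, u \in A :|: B & exists2 c, c \in S & seg v u c.
  have [vA|vB] := setUP vX; first by exists b => //; exact: hAB.
  by exists a => //; exact: (hits_sym hAB).
have uv : u != v.
  apply/eqP => e'; case: sc => t ti; rewrite e' => -[ex ey].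
  suff cv : c = v by have := XS v vX; rewrite -cv cS.
  by apply: coord_inj; rewrite ?ex ?ey; ring.
have Mc : M c = 0 by apply: (aff_seg_eq aM sc); exact: MX.
have gc : g v < g c by apply: (aff_seg_gt ag (seg_sym sc)) => //; exact: vlt.
have [[w evw wX]|nw] := pselect (exists2 w, e v w & w \in A :|: B); last first.
  apply: subset_leq_card; apply/subsetP => w; rewrite inE => evw.
  by apply/negPn/negP => wS; apply: nw; exists w => //; rewrite eS inE.
have wv : w != v by have /vis[] := evw; rewrite eq_sym.
(* Of two points on one ray from [v], the nearer hides the farther, and [w] is visible. *)
have ncw : ~~ e v c.
  apply/negP => /vis[_ nsc]; have /vis[_ nsw] := evw.
  case: (ltgtP (g c) (g w)) => lt.
  - by apply: (nsw c); apply: btw => //; exact: MX.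
  - by apply: (nsc w); apply: btw => //; [exact: MX|exact: MX|exact: vlt].
  - by have := XS w wX; rewrite -(gI c w Mc (MX w wX) lt) cS.
have : [set i | e v i] \subset w |: (S :\ c).
  apply/subsetP => i; rewrite !inE => evi.
  have [//|iw] := eqVneq i w; have [ic|ic] := eqVneq i c; first by move: ncw; rewrite -ic evi.
  rewrite /=; apply/negPn/negP => iS.
  have iX : i \in A :|: B by rewrite eS inE.
  have iv : i != v by have /vis[] := evi; rewrite eq_sym.
  have /vis[_ nsi] := evi; have /vis[_ nsw] := evw.
  case: (ltgtP (g i) (g w)) => lt.
  - by apply: (nsw i); apply: btw; rewrite ?MX ?vlt.
  - by apply: (nsi w); apply: btw; rewrite ?MX ?vlt.
  - by move/eqP: iw; apply; apply: gI; rewrite ?MX.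
move=> /subset_leq_card/leq_trans; apply.
rewrite (leq_trans (leq_card_setU _ _).1) // cards1 (cardsD1 c S) cS.
by [].
Qed.

Lemma cut_degree (e : rel T) A B S : visible_rel e -> symmetric e -> ~ coll [set: T] ->
  [disjoint A & B] -> A :|: B = ~: S ->
  (forall a b, a \in A -> b \in B -> ~~ e a b) ->
  A != set0 -> B != set0 ->
  exists v, (#|[set w | e v w]| + 2 <= 2 * #|S|)%N.
Proof.
move=> vis esym ncT dAB eS nAB An Bn.
have hAB := hits_of_cut vis dAB eS nAB.
have [cX|ncX] := pselect (coll (A :|: B)).
  have [v vX dv] := coll_end_degree vis dAB eS nAB An Bn cX; exists v.
  suff : (1 < #|S|)%N by move: dv; card_lia.
  have /set0Pn[a aA] := An; have /set0Pn[b bB] := Bn.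
  have ab : a <> b by move=> e'; move: (disjointFr dAB aA); rewrite e' bB.
  have [aX bX] : a \in A :|: B /\ b \in A :|: B by rewrite !inE aA bB orbT.
  have fr := frame0.
  have [c cS sc] := hAB a b aA bB.
  have Mc : det x0 y0 a b c = 0.
    by apply: (aff_seg_eq (det_aff a b fr) sc); exact: cX.
  (* A point off the common line of [A] and [B] must be in [S]; with the blocker [c] on the line it
     gives two points of [S]. *)
  have [u Mu] : exists u, det x0 y0 a b u != 0.
    apply: contrapT => nu; apply: ncT => i j k _ _ _.
    have M0 w : det x0 y0 a b w = 0.
      by apply/eqP/negPn/negP => mw; apply: nu; exists w.
    exact: (det_line fr ab).
  apply/card_gt1P; exists c, u; split=> //; last by apply: contraNneq Mu => <-; rewrite Mc.
  by apply: contraNT Mu => uS; apply/eqP/cX => //; rewrite eS inE.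
have bb := blocking_bound dAB An Bn ncX hAB.
(* Neighbours of [v] lie in its own class or in [S], and [v] itself is excluded. *)
have deg (Q Q' : {set T}) v : Q :|: Q' = ~: S ->
    (forall i j, i \in Q -> j \in Q' -> ~~ e i j) -> v \in Q ->
    (#|[set w | e v w]| < #|Q| + #|S|)%N.
  move=> eQ nQ vQ; have : [set w | e v w] \subset (Q :\ v) :|: S.
    apply/subsetP => w; rewrite !inE => evw.
    have -> : w != v by have /vis[] := evw; rewrite eq_sym.
    apply/orP; have [|wS] := boolP (w \in S); [by right|left=> /=].
    have : w \in Q :|: Q' by rewrite eQ inE.
    by rewrite inE => /orP[//|wQ']; move: (nQ v w vQ wQ'); rewrite evw.
  move=> /subset_leq_card; have [+ _] := leq_card_setU (Q :\ v) S.
  by rewrite (cardsD1 v Q) vQ /=; card_lia.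
have /set0Pn[a aA] := An; have /set0Pn[b bB] := Bn.
have [le|lt] := leqP #|A| #|B|.
  by exists a; move: (deg A B a eS nAB aA) le bb; card_lia.
have nBA i j : i \in B -> j \in A -> ~~ e i j by move=> iB jA; rewrite esym nAB.
by exists b; have := deg B A b; rewrite setUC => /(_ eS nBA bB); move: lt bb; card_lia.
Qed.

End PlanarPoints.

(** * Passage to point sets in the plane and the final count *)

Lemma min_degree_le (T : finType) (e : rel T) v : (min_degree e <= degree e v)%N.
Proof.
rewrite /min_degree; have: v \in index_enum T by rewrite mem_index_enum.
elim: (index_enum T) => // w s IH; rewrite inE big_cons => /orP[/eqP ->|/IH le].
  exact: geq_minl.
exact: leq_trans (geq_minr _ _) le.
Qed.

Lemma vertex_connectivity_ge (T : finType) (e : rel T) k :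
  vertex_connected e k -> (k <= vertex_connectivity e)%N.
Proof.
move=> vk; have /andP[kT _] := vk.
exact: (@leq_bigmax_cond _ (fun k : 'I_#|T| => vertex_connected e k) _ (Ordinal kT)).
Qed.

Section Coordinates.
Variables (R : realType) (P : {fset 'rV[R]_2}).

Definition coordx (v : P) : R := val v ord0 ord0.
Definition coordy (v : P) : R := val v ord0 ord_max.

Lemma rV2_eq (u v : 'rV[R]_2) :
  u ord0 ord0 = v ord0 ord0 -> u ord0 ord_max = v ord0 ord_max -> u = v.
Proof.
move=> e0 e1; apply/rowP => -[[|[|//]] h].
  by rewrite (_ : Ordinal h = ord0) //; exact: val_inj.
by rewrite (_ : Ordinal h = ord_max) //; exact: val_inj.
Qed.

Lemma coord_inj (i j : P) : coordx i = coordx j -> coordy i = coordy j -> i = j.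
Proof. by move=> ex ey; apply/val_inj/rV2_eq. Qed.

Lemma open_segmentE (a b c : P) :
  open_segment (val a) (val b) (val c) <-> seg coordx coordy a b c.
Proof.
split=> [[t ti e]|[t ti [ex ey]]]; exists t => //.
  by rewrite /coordx /coordy e !mxE.
by apply: rV2_eq; rewrite !mxE.
Qed.

Lemma visibility_graphP : visible_rel coordx coordy (visibility_graph P).
Proof.
move=> a b; split=> [/asboolP[ne nx]|[ne nx]].
  split; first by apply/eqP => e; apply: ne; rewrite e.
  by move=> c /open_segmentE; apply: nx; exact: valP.
apply/asboolP; split; first by move=> /val_inj e; rewrite e eqxx in ne.
by move=> x xP /(open_segmentE a b [` xP]%fset); exact: nx.
Qed.

Lemma visibility_graph_sym : symmetric (visibility_graph P).
Proof.
move=> a b; apply/idP/idP => /visibility_graphP[ne nx]; apply/visibility_graphP.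
  by split=> [|c /seg_sym]; [rewrite eq_sym|exact: nx].
by split=> [|c /seg_sym]; [rewrite eq_sym|exact: nx].
Qed.

Lemma noncollinear_coord : ~ collinear P -> ~ coll coordx coordy [set: P].
Proof.
move=> ncP cT; apply: ncP.
(* With fewer than two points, any direction gives a line containing [P]. *)
have [[i [j ij]]|one] := pselect (exists i j : P, i != j); last first.
  have d0 : const_mx 1 <> 0 :> 'rV[R]_2.
    by move=> /rowP/(_ ord0); rewrite !mxE => /eqP; rewrite oner_eq0.
  have [[a aP]|empty] := pselect (exists a, a \in P).
    exists a, (const_mx 1); split=> // x xP; exists 0; rewrite scale0r addr0.
    have := contrapT (fun ne => one (ex_intro _ [` xP]%fset (ex_intro _ [` aP]%fset (introN eqP ne)))).
    by move=> /(congr1 val).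
  by exists 0, (const_mx 1); split=> // x xP; case: empty; exists x.
exists (val i), (val j - val i); split.
  by move=> /eqP; rewrite subr_eq0 => /eqP/val_inj e; rewrite e eqxx in ij.
move=> x xP; have := cT i j [` xP]%fset (in_setT _) (in_setT _) (in_setT _).
rewrite /det /coordx /coordy /=.
set xi := val i ord0 ord0; set yi := val i ord0 ord_max.
set xj := val j ord0 ord0; set yj := val j ord0 ord_max => e.
(* The parameter is read off a coordinate in which [i] and [j] differ. *)
have [ex|nx] := eqVneq xj xi.
  have ny : yj != yi.
    apply: contra ij => /eqP ey; apply/eqP/val_inj/rV2_eq; exact/esym.
  exists ((x ord0 ord_max - yi) / (yj - yi)); apply: rV2_eq; rewrite !mxE -/xi -/yi -/xj -/yj.
    move: e; rewrite ex subrr mul0r sub0r mulr0 addr0 => /eqP.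
    by rewrite oppr_eq0 mulf_eq0 !subr_eq0 (negPf ny) => /eqP.
  by rewrite divfK ?subr_eq0 // addrC subrK.
exists ((x ord0 ord0 - xi) / (xj - xi)); apply: rV2_eq; rewrite !mxE -/xi -/yi -/xj -/yj.
  by rewrite divfK ?subr_eq0 // addrC subrK.
apply/eqP; rewrite -subr_eq0 -(mulrI_eq0 _ (mulfI (_ : xj - xi != 0))) ?subr_eq0 //.
apply/eqP; rewrite -[RHS]e; field.
by rewrite subr_eq0.
Qed.

End Coordinates.

Theorem theorem11 (R : realType) (P : {fset 'rV[R]_2}) :
  ~ collinear P ->
  (min_degree (visibility_graph P))%:R / 2 + 1
    <= (vertex_connectivity (visibility_graph P))%:R :> R.
Proof.
move=> /noncollinear_coord ncT.
set e := visibility_graph P; have eP : visible_rel _ _ e := @visibility_graphP R P.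
(* The integer form of the bound: half the minimum degree, rounded up, plus one. *)
suff vc : vertex_connected e (uphalf (min_degree e)).+1.
  have := vertex_connectivity_ge vc; rewrite -(ler_nat R); apply: le_trans.
  rewrite -[leRHS]natr1 lerD2r ler_pdivrMr // -natrM ler_nat.
  by rewrite muln2 uphalfK leq_addl.
have [i [j [k dijk]]] : exists i j k, det (@coordx R P) (@coordy R P) i j k != 0.
  apply: contrapT => nd; apply: ncT => i j k _ _ _.
  by apply/eqP/negPn/negP => d; apply: nd; exists i, j, k.
have T3 : (2 < #|{: P}|)%N.
  apply/card_gt2P; exists i, j, k; split=> //; split; apply: contraNneq dijk => ->;
    by rewrite /det; apply/eqP; ring.
have dmax : (min_degree e < #|{: P}|)%N.
  apply: leq_ltn_trans (min_degree_le e i) _.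
  rewrite [X in (_ < X)%N](cardD1 i) /= ltnS; apply: subset_leq_card.
  by apply/subsetP => w; rewrite !inE andbT => /eP[]; rewrite eq_sym.
(* At least three vertices are needed here: with two, minimum degree one would ask for
   two-connectivity. *)
apply/andP; split; first by move: T3 dmax; set n := #|_|; set d := min_degree e; lia.
apply/forallP => S; apply/implyP => Sk; apply: contraT.
rewrite negb_forall => /existsP[v]; rewrite negb_imply => /andP[vS].
rewrite negb_forall => /existsP[w]; rewrite negb_imply => /andP[wS nvw].
rewrite !in_setC in vS wS.
pose A := [set u in ~: S | connect (del_rel e S) v u].
pose B := [set u in ~: S | ~~ connect (del_rel e S) v u].
have [|||||||d] := @cut_degree R P (@coordx R P) (@coordy R P) (@coord_inj R P) e A B S eP.
- exact: visibility_graph_sym.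
- exact: ncT.
- rewrite -setI_eq0; apply/eqP/setP => u; rewrite !inE.
  by case: (connect _ _ _); rewrite ?andbF.
- by apply/setP => u; rewrite !inE; case: (connect _ _ _); rewrite ?andbF ?andbT ?orbF.
- move=> a b; rewrite !inE => /andP[aS va] /andP[bS]; apply: contra => eab.
  by apply: connect_trans va (connect1 _); rewrite /del_rel /= eab aS bS.
- by apply/set0Pn; exists v; rewrite !inE vS connect0.
- by apply/set0Pn; exists w; rewrite !inE wS.
rewrite cardsE => dS; have := min_degree_le e d; rewrite /degree.
(* Twice [#|S|] is at most the minimum degree plus one, while [dS] makes it at least the minimum
   degree plus two. *)
move: dS Sk; set n1 := #|_|; set n2 := #|_|; set n3 := min_degree e; lia.
Qed.
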